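(* There exists a constant $\tilde\rho>0$ such that for every $n\in\mathbb{N}$, every $\mathbf{a}\in\mathsf{R}(n)$ and every $z\in\overline{\mathcal{C}_n(\mathbf{a})}$, \[ \#G_n(z,\mathbf{a},\tilde\rho)\le6,\qquad G_n(z,\mathbf{a},\tilde\rho)\subseteq\{\mathbf{a}\}\cup V_n(\mathbf{a}), \] and \[ \mathbb{D}\big(z;\tilde\rho\,|\mathcal{C}_n(\mathbf{a})|\big)\cap\overline{\mathfrak{F}}\subseteq\bigcup_{\mathbf{b}\in G_n(z,\mathbf{a},\tilde\rho)}\overline{\mathcal{C}_n(\mathbf{b})}. \]
   Context: $\mathscr{D}:=\{a\in\mathbb{Z}[i]:|a|\geq\sqrt2\}$. Let $[z]:=\lfloor \Re z+\tfrac12\rfloor+i\lfloor \Im z+\tfrac12\rfloor$, $\mathfrak{F}:=\{z\in\mathbb{C}:[z]=0\}$, $T(z)=z^{-1}-[z^{-1}]$ ($z\ne0$), $T(0)=0$, Hurwitz partial quotients $a_1(z)=[z^{-1}]$, $a_n(z)=a_1(T^{n-1}z)$. The cylinder of $(a_1,\dots,a_n)\in\mathscr{D}^n$ is $\mathcal{C}_n(a_1,\dots,a_n)=\{z\in\mathfrak{F}:a_j(z)=a_j,1\le j\le n\}$; $\mathsf{R}(n)$ is the set of words whose cylinder has non-empty interior. Overlines denote closures, $|A|$ is the diameter of $A$, and $\mathbb{D}(z;r)$ the open disc of center $z$ and radius $r$. For $\mathbf{a}\in\mathsf{R}(n)$, the set of neighbors is $V_n(\mathbf{a}):=\{\mathbf{b}\in\mathsf{R}(n):\mathbf{b}\ne\mathbf{a},\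 \overline{\mathcal{C}_n(\mathbf{a})}\cap\overline{\mathcal{C}_n(\mathbf{b})}\ne\emptyset\}$, and for $\rho>0$, $z\in\overline{\mathfrak{F}}$, $G_n(z,\mathbf{a},\rho):=\{\mathbf{b}\in\mathsf{R}(n):\mathbb{D}(z;\rho|\mathcal{C}_n(\mathbf{a})|)\cap\overline{\mathcal{C}_n(\mathbf{b})}\ne\emptyset\}$. *)

(* Defs.v *)
From HB Require Import structures.
From mathcomp Require Import all_boot all_order all_algebra.
From mathcomp Require Import all_classical all_reals all_analysis.
From mathcomp Require Import complex.

Set Implicit Arguments.
Unset Strict Implicit.
Unset Printing Implicit Defensive.

Import Order.TTheory GRing.Theory Num.Theory numFieldNormedType.Exports.

Local Open Scope classical_set_scope.
Local Open Scope complex_scope.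
Local Open Scope ring_scope.

(* The norm topology on R[i]; the library declares it only on the alias R[i]^o
   and on abstract numFieldTypes. *)
#[warnings="-redundant-canonical-projection"]
HB.instance Definition _ (R : realType) := NormedModule.copy R[i] R[i]^o.

Definition gauss_int (R : realType) : set R[i] :=
  [set a | complex.Re a \is a Num.int /\ complex.Im a \is a Num.int].

Definition hdigits (R : realType) : set R[i] :=
  [set a | gauss_int a /\ Num.sqrt 2 <= Normc.normc a].

Definition nearest (R : realType) (z : R[i]) : R[i] :=
  (Num.floor (complex.Re z + 2^-1))%:~R +i* (Num.floor (complex.Im z + 2^-1))%:~R.

Definition hsquare (R : realType) : set R[i] := [set z | nearest z = 0].

Definition hurwitz_map (R : realType) (z : R[i]) : R[i] :=
  if z == 0 then 0 else z^-1 - nearest z^-1.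

(* Indexed from 0: [partial_quotient j z] is a_(j+1)(z).  When a_(j+1)(z) is
   undefined, i.e. when the j-th iterate of z is 0, its value is
   nearest 0^-1 = 0, which is never in [hdigits]. *)
Definition partial_quotient (R : realType) (j : nat) (z : R[i]) : R[i] :=
  nearest (iter j (@hurwitz_map R) z)^-1.

Definition cylinder (R : realType) (n : nat) (a : n.-tuple R[i]) : set R[i] :=
  [set z | hsquare z /\ forall j : 'I_n, partial_quotient j z = tnth a j].

Definition regular_word (R : realType) (n : nat) : set (n.-tuple R[i]) :=
  [set a | (forall j : 'I_n, hdigits (tnth a j)) /\ interior (cylinder a) !=set0].

Definition diam (R : realType) (A : set R[i]) : R :=
  sup [set d | exists x y, [/\ A x, A y & d = Normc.normc (x - y)]].

Definition disc (R : realType) (z : R[i]) (r : R) : set R[i] :=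
  ball z r%:C.

Definition neighbors (R : realType) (n : nat) (a : n.-tuple R[i]) :
    set (n.-tuple R[i]) :=
  [set b | [/\ regular_word b, b <> a &
    closure (cylinder a) `&` closure (cylinder b) !=set0]].

Definition near_words (R : realType) (n : nat) (z : R[i]) (a : n.-tuple R[i])
    (rho : R) : set (n.-tuple R[i]) :=
  [set b | regular_word b /\
    disc z (rho * diam (cylinder a)) `&` closure (cylinder b) !=set0].

(* Main.v *)
(* The Gauss map of Hurwitz continued fractions sends every cylinder onto a
   square with some discs of radius 1 removed, the discs being centred at
   Gaussian integers of norm 1 or 2; which discs occur is determined digit by
   digit.  Fix a cylinder [a] with coordinate [t = T^n], and a nearby cylinder
   [b].  Following the two orbits simultaneously, the change of coordinates
   between them is at each step a Moebius map with Gaussian integer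
   coefficients which, at the limit point [v] under consideration, is an
   isometry to first order and carries [v] to its image under a symmetry of the
   square (it is a product of reflections in lines and circles through [v]).
   Such maps carry the finitely many lines and circles that bound tiles at [v]
   to one another.  At [v] at most three of these curves cross, at angles of
   [pi / 3], so there are at most six sectors, and every nearby tile has [v] in
   its closure and contains the bisector of a sector.  Two distinct cylinders
   cannot contain the same bisector, so at most six tiles come near.
   Uniformity in [v] follows from compactness of the square and uniformity in
   [a] from bounded distortion; cylinders of generic points are dense, which
   gives the covering. *)
Require Import Defs.
From mathcomp Require Import all_boot all_order all_algebra.
From mathcomp Require Import all_classical all_reals all_analysis.
From mathcomp Require Import complex ring lra.
Import Order.TTheory GRing.Theory Num.Theory numFieldNormedType.Exports.
Local Open Scope classical_set_scope.
Local Open Scope complex_scope.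
Local Open Scope ring_scope.

Set Implicit Arguments.
Unset Strict Implicit.
Unset Printing Implicit Defensive.

Local Notation Re := complex.Re.
Local Notation Im := complex.Im.

(** * Complex coordinates and Gaussian integers *)

Section Norm.
Context (R : realType).
Implicit Types z w u c d : R[i].

(** The obstacle is that two nearby orbits may choose different digits at every step, so the changes
    of coordinates [m] could vary without bound. What limits them is a bound on one coefficient:
    while the coordinate of the limit point is not 0, [n2 (mc m) <= 1]. Then [m] is a Euclidean
    isometry, or an inversion in a unit circle about a Gaussian integer followed by one, and every
    wall that matters (a line at half-integer height, or a unit circle about a Gaussian integer)
    pulls back to such a wall. The bound survives a step because the new [mc] is the old [mb], and
    [mb] is controlled by integrality and parity. It fails only at a corner of the square. The
    inverse of a corner is a Gaussian integer, so the next coordinate is 0; since a coordinate 0 is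
    not of the form [(d + t)^-1], this happens at the last step only. The limit point usually lies
    on walls, where its own digits are ambiguous. A nearby point of the second cylinder chooses
    them, and [unsep] guarantees that the limit point agrees up to the closed square. That is why
    its image is known only up to the symmetries of the square. *)

Definition n2 z : R := Re z ^+ 2 + Im z ^+ 2.

Lemma ReMul z w : Re (z * w) = Re z * Re w - Im z * Im w.
Proof. by case: z; case: w. Qed.

Lemma ImMul z w : Im (z * w) = Re z * Im w + Im z * Re w.
Proof. by case: z; case: w. Qed.

Lemma ReAdd z w : Re (z + w) = Re z + Re w. Proof. by case: z; case: w. Qed.
Lemma ImAdd z w : Im (z + w) = Im z + Im w. Proof. by case: z; case: w. Qed.
Lemma ReOpp z : Re (- z) = - Re z. Proof. by case: z. Qed.
Lemma ImOpp z : Im (- z) = - Im z. Proof. by case: z. Qed.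
Lemma ReConj z : Re z^*%C = Re z. Proof. by case: z. Qed.
Lemma ImConj z : Im z^*%C = - Im z. Proof. by case: z. Qed.
Lemma ReOne : Re (1 : R[i]) = 1. Proof. by []. Qed.
Lemma ImOne : Im (1 : R[i]) = 0. Proof. by []. Qed.
Lemma ReZero : Re (0 : R[i]) = 0. Proof. by []. Qed.
Lemma ImZero : Im (0 : R[i]) = 0. Proof. by []. Qed.
Lemma ReI : Re ('i : R[i]) = 0. Proof. by []. Qed.
Lemma ImI : Im ('i : R[i]) = 1. Proof. by []. Qed.

Lemma ReReal (r : R) : Re r%:C = r. Proof. by []. Qed.
Lemma ImReal (r : R) : Im r%:C = 0. Proof. by []. Qed.

Definition reimE := (ReMul, ImMul, ReAdd, ImAdd, ReOpp, ImOpp, ReConj, ImConj,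
  (ReOne, ImOne, ReZero, ImZero, ReI, ImI, ReReal, ImReal)).

Lemma complexP z w : Re z = Re w -> Im z = Im w -> z = w.
Proof. by case: z => a b; case: w => c d /= -> ->. Qed.

Lemma ReInv z : Re z^-1 = Re z / n2 z. Proof. by case: z. Qed.
Lemma ImInv z : Im z^-1 = - (Im z / n2 z).
Proof. by case: z. Qed.

Lemma n2_ge0 z : 0 <= n2 z. Proof. by rewrite addr_ge0 ?sqr_ge0. Qed.

Lemma n2M z w : n2 (z * w) = n2 z * n2 w.
Proof. by rewrite /n2 !reimE; ring. Qed.

Lemma n2N z : n2 (- z) = n2 z. Proof. by rewrite /n2 !reimE; ring. Qed.
Lemma n2J z : n2 z^*%C = n2 z. Proof. by rewrite /n2 !reimE; ring. Qed.
Lemma n2_parallelogram z w : n2 (z - w) + n2 (z + w) = 2 * (n2 z + n2 w).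
Proof. by rewrite /n2 !reimE; ring. Qed.
Lemma n2_1 : n2 1 = 1. Proof. by rewrite /n2 !reimE; ring. Qed.
Lemma n2_0 : n2 0 = 0. Proof. by rewrite /n2 !reimE; ring. Qed.

Lemma n2_eq0 z : (n2 z == 0) = (z == 0).
Proof.
apply/eqP/eqP => [|->]; last exact: n2_0.
by move/eqP; rewrite paddr_eq0 ?sqr_ge0// !sqrf_eq0 => /andP[/eqP a /eqP b]; apply: complexP.
Qed.

Lemma n2_gt0 z : (0 < n2 z) = (z != 0).
Proof. by rewrite lt_def n2_ge0 andbT n2_eq0. Qed.

Lemma n2V z : n2 z^-1 = (n2 z)^-1.
Proof.
have [->|z0] := eqVneq z 0; first by rewrite invr0 n2_0 invr0.
have z1 : n2 z != 0 by rewrite n2_eq0.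
by apply: (mulfI z1); rewrite -n2M !divff// n2_1.
Qed.

Lemma n2_normc z : n2 z = Normc.normc z ^+ 2.
Proof. by case: z => a b; rewrite /n2 /= sqr_sqrtr// addr_ge0 ?sqr_ge0. Qed.

Lemma normc_ge0 z : 0 <= Normc.normc z.
Proof. by case: z => a b; exact: sqrtr_ge0. Qed.

Lemma normc_lt z (r : R) : 0 <= r -> (Normc.normc z < r) = (n2 z < r ^+ 2).
Proof. by move=> r0; rewrite n2_normc ltr_pXn2r ?nnegrE ?normc_ge0. Qed.

Lemma normc_le z (r : R) : 0 <= r -> (Normc.normc z <= r) = (n2 z <= r ^+ 2).
Proof. by move=> r0; rewrite n2_normc ler_pXn2r ?nnegrE ?normc_ge0. Qed.

Lemma normc_Re z : `|Re z| <= Normc.normc z.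
Proof.
rewrite -(@ler_pXn2r _ 2)// ?nnegrE ?normc_ge0// -n2_normc real_normK ?num_real//.
by rewrite lerDl sqr_ge0.
Qed.

Lemma normc_Im z : `|Im z| <= Normc.normc z.
Proof.
rewrite -(@ler_pXn2r _ 2)// ?nnegrE ?normc_ge0// -n2_normc real_normK ?num_real//.
by rewrite lerDr sqr_ge0.
Qed.

Lemma normcB z w : Normc.normc (z - w) = Normc.normc (w - z).
Proof. by rewrite -normcN opprB. Qed.

Lemma normc_tri z w c : Normc.normc (z - w) <= Normc.normc (z - c) + Normc.normc (c - w).
Proof. by rewrite (_ : z - w = (z - c) + (c - w)) ?le_normcD//; ring. Qed.

Lemma normc_eq0 z : (Normc.normc z == 0) = (z == 0).
Proof. by rewrite -n2_eq0 n2_normc sqrf_eq0. Qed.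

Lemma normc_gt0 z : (0 < Normc.normc z) = (z != 0).
Proof. by rewrite lt_def normc_ge0 andbT normc_eq0. Qed.

Lemma gauss_mk (m n : int) : gauss_int (m%:~R +i* n%:~R : R[i]).
Proof. by split; rewrite intr_int. Qed.

Lemma gaussD c d : gauss_int c -> gauss_int d -> gauss_int (c + d).
Proof. by move=> [a b] [a' b']; split; rewrite !reimE rpredD. Qed.
Lemma gaussN c : gauss_int c -> gauss_int (- c).
Proof. by move=> [a b]; split; rewrite !reimE rpredN. Qed.
Lemma gaussB c d : gauss_int c -> gauss_int d -> gauss_int (c - d).
Proof. by move=> a b; apply/gaussD/gaussN. Qed.
Lemma gaussM c d : gauss_int c -> gauss_int d -> gauss_int (c * d).
Proof. by move=> [a b] [a' b']; split; rewrite !reimE ?rpredB ?rpredD ?rpredM. Qed.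
Lemma gaussJ c : gauss_int c -> gauss_int c^*%C.
Proof. by move=> [a b]; split; rewrite !reimE ?rpredN. Qed.
Lemma gauss1 : gauss_int (1 : R[i]). Proof. by split; rewrite !reimE ?rpred1 ?rpred0. Qed.
Lemma gauss0 : gauss_int (0 : R[i]). Proof. by split; rewrite !reimE rpred0. Qed.
Lemma gaussI : gauss_int ('i : R[i]). Proof. by split; rewrite !reimE ?rpred0 ?rpred1. Qed.

Lemma gauss_n2 c : gauss_int c -> n2 c \is a Num.int.
Proof. by move=> [a b]; rewrite rpredD ?rpredX. Qed.

Lemma int_lt1 (x : R) : x \is a Num.int -> x < 1 -> x <= 0.
Proof. by move=> /intrP[m ->]; rewrite (ltr_int R m 1) (ler_int R m 0); case: m => [[]|]. Qed.

Lemma int_gtN1 (x : R) : x \is a Num.int -> -1 < x -> 0 <= x.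
Proof. by move=> xi x1; rewrite -oppr_le0 int_lt1 ?rpredN// ltrNl. Qed.

Lemma int_ltD (x y : R) : x \is a Num.int -> y \is a Num.int -> x < y + 1 -> x <= y.
Proof. by move=> xi yi xy; rewrite -subr_le0 int_lt1 ?rpredB// ltrBlDl. Qed.

Lemma int_cases (x : R) : x \is a Num.int -> -2 < x -> x < 2 -> [\/ x = -1, x = 0 | x = 1].
Proof.
move=> xi xl xu; have [x0|x0] := ltP x 0.
  have : x + 1 <= 0 by apply: int_lt1; [rewrite rpredD ?rpred1|lra].
  have : 0 <= x + 1 by apply: int_gtN1; [rewrite rpredD ?rpred1|lra].
  by move=> ? ?; constructor 1; lra.
have [x1|x1] := ltP x 1; first by constructor 2; have := int_lt1 xi x1; lra.
have : x - 1 <= 0 by apply: int_lt1; [rewrite rpredB ?rpred1|lra].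
by move=> ?; constructor 3; lra.
Qed.
End Norm.

(** * Tiles *)

Section Tiles.
Context (R : realType).
Implicit Types z w u c d t x : R[i].
Implicit Types S : set R[i].

Definition gunit u := gauss_int u /\ n2 u = 1.

Lemma gunitP u : gunit u -> [\/ u = 1, u = -1, u = 'i | u = - 'i].
Proof.
move=> [[ai bi]]; rewrite /n2 => h.
have [a|a|a] : [\/ Re u = -1, Re u = 0 | Re u = 1] by apply: int_cases => //; nra.
- by constructor 2; apply: complexP; rewrite !reimE ?a //; nra.
- have [b|b|b] : [\/ Im u = -1, Im u = 0 | Im u = 1] by apply: int_cases => //; nra.
  + by constructor 4; apply: complexP; rewrite !reimE; lra.
  + by move: h; rewrite a b; lra.
  + by constructor 3; apply: complexP; rewrite !reimE; lra.
- by constructor 1; apply: complexP; rewrite !reimE ?a //; nra.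
Qed.

Lemma gunit1 : gunit 1. Proof. by split; [exact: gauss1|rewrite n2_1]. Qed.
Lemma gunitI : gunit 'i. Proof. by split; [exact: gaussI|rewrite /n2 !reimE; ring]. Qed.
Lemma gunitN u : gunit u -> gunit (- u).
Proof. by move=> [a b]; split; [exact: gaussN|rewrite n2N]. Qed.
Lemma gunitJ u : gunit u -> gunit u^*%C.
Proof. by move=> [a b]; split; [exact: gaussJ|rewrite n2J]. Qed.
Lemma gunitM u v : gunit u -> gunit v -> gunit (u * v).
Proof. by move=> [a b] [a' b']; split; [exact: gaussM|rewrite n2M b b' mulr1]. Qed.
Lemma gunit_neq0 u : gunit u -> u != 0.
Proof. by move=> [_ h]; rewrite -n2_gt0 h. Qed.
Lemma gunitMJ u : gunit u -> u * u^*%C = 1.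
Proof. by move=> [_ h]; apply: complexP; rewrite !reimE; move: h; rewrite /n2; lra. Qed.
Lemma gunitV u : gunit u -> u^-1 = u^*%C.
Proof. by move=> h; apply: (mulfI (gunit_neq0 h)); rewrite gunitMJ// divff// gunit_neq0. Qed.

(* [lte true] is [<], [lte false] is [<=]: open and closed tiles are treated uniformly. *)
Definition lte (b : bool) (x y : R) := if b then x < y else x <= y.

(** Quantifying over units treats the four sides alike and lets [inv_half] invert all of them at
    once. *)
Definition insq b z := forall u, gunit u -> lte b (Re (u * z)) 2^-1.

Lemma insqP b z : insq b z <->
  [/\ lte b (Re z) 2^-1, lte b (- Re z) 2^-1, lte b (Im z) 2^-1 & lte b (- Im z) 2^-1].
Proof.
split=> [h|[h1 h2 h3 h4] u /gunitP[]->]; last 4 first.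
- by rewrite mul1r.
- by rewrite mulN1r ReOpp.
- by rewrite !reimE mul0r mul1r add0r.
- by rewrite !reimE oppr0 mul0r mulN1r opprK add0r.
split.
- by have := h _ gunit1; rewrite mul1r.
- by have := h _ (gunitN gunit1); rewrite mulN1r ReOpp.
- by have := h _ (gunitN gunitI); rewrite !reimE oppr0 mul0r mulN1r opprK add0r.
- by have := h _ gunitI; rewrite !reimE mul0r mul1r add0r.
Qed.

Lemma csqP z : insq false z <->
  [/\ - 2^-1 <= Re z, Re z <= 2^-1, - 2^-1 <= Im z & Im z <= 2^-1].
Proof. by rewrite insqP /lte; split=> -[? ? ? ?]; split; lra. Qed.

Lemma osqP z : insq true z <->
  [/\ - 2^-1 < Re z, Re z < 2^-1, - 2^-1 < Im z & Im z < 2^-1].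
Proof. by rewrite insqP /lte; split=> -[? ? ? ?]; split; lra. Qed.

Lemma osq_csq z : insq true z -> insq false z.
Proof. by move=> h u /h /ltW. Qed.

Lemma csq_n2 z : insq false z -> n2 z <= 2^-1.
Proof. by move=> /csqP[? ? ? ?]; rewrite /n2; nra. Qed.

(** Multiplied by [n2 w], both conditions compare [2 (Re u Re w + Im u Im w)] with [n2 w]. Inversion
    exchanges the sides of the square with the unit circles about units. *)
Lemma inv_half b w u : w != 0 -> n2 u = 1 ->
  lte b (Re (u * w^-1)) 2^-1 = lte b 1 (n2 (w - u)).
Proof.
rewrite -n2_gt0 => w0 u1.
have -> : Re (u * w^-1) = (Re u * Re w + Im u * Im w) / n2 w.
  by rewrite !reimE ReInv ImInv; field; rewrite gt_eqF.
have e : n2 (w - u) = n2 w - 2 * (Re u * Re w + Im u * Im w) + 1.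
  by rewrite -[X in _ = _ + X]u1 /n2 !reimE; ring.
by rewrite e /lte; case: b; rewrite ?ltr_pdivrMr ?ler_pdivrMr//; apply/idP/idP; lra.
Qed.

Lemma n2_invB w c : w != 0 -> n2 (w^-1 - c) = n2 (1 - c * w) / n2 w.
Proof.
move=> w0; rewrite -n2V -n2M; congr n2; field.
by [].
Qed.

Lemma inv_unit b w c : w != 0 -> n2 c = 1 ->
  lte b 1 (n2 (w^-1 - c)) = lte b (Re (c * w)) 2^-1.
Proof.
move=> w0 c1; rewrite n2_invB//.
have e : n2 (1 - c * w) = 1 - 2 * Re (c * w) + n2 w.
  by rewrite -[X in _ = _ + X]mul1r -[X in _ = _ + X * _]c1 /n2 !reimE; ring.
move: w0; rewrite -n2_gt0 => w0.
by rewrite e /lte; case: b; rewrite ?ltr_pdivlMr ?ler_pdivlMr//; apply/idP/idP; lra.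
Qed.

Lemma inv_unitI w c : w != 0 -> n2 c = 1 ->
  (n2 (w^-1 - c) < 1) = (2^-1 < Re (c * w)).
Proof.
by move=> w0 c1; rewrite !real_ltNge ?num_real//; congr (~~ _); exact: (@inv_unit false).
Qed.

(** A unit circle about [c] with [n2 c = 2] is orthogonal to the unit circle about 0, so inversion
    only conjugates its centre. *)
Lemma inv_diag b w c : w != 0 -> n2 c = 2 ->
  lte b 1 (n2 (w^-1 - c)) = lte b 1 (n2 (w - c^*%C)).
Proof.
move=> w0 c1; rewrite n2_invB//.
have e : n2 (1 - c * w) = 1 - 2 * Re (c * w) + 2 * n2 w.
  by rewrite -[X in _ = _ + X * _]c1 /n2 !reimE; ring.
have e' : n2 (w - c^*%C) = 2 - 2 * Re (c * w) + n2 w.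
  by rewrite -[X in _ = X - _ + _]c1 /n2 !reimE; ring.
move: w0; rewrite -n2_gt0 => w0.
by rewrite e e' /lte; case: b; rewrite ?ltr_pdivlMr ?ler_pdivlMr//; apply/idP/idP; lra.
Qed.

Lemma inv_diagI w c : w != 0 -> n2 c = 2 ->
  (n2 (w^-1 - c) < 1) = (n2 (w - c^*%C) < 1).
Proof.
by move=> w0 c1; rewrite !real_ltNge ?num_real//; congr (~~ _); exact: (@inv_diag false).
Qed.

Definition gcenter c := gauss_int c /\ (n2 c = 1 \/ n2 c = 2).

(** The square enlarged by 1/10: room for every perturbation below, still inside the open unit disc
    and farther than 1 from each Gaussian integer with [2 < n2]. *)
Definition near_sq x := [/\ - (3 / 5) <= Re x, Re x <= 3 / 5, - (3 / 5) <= Im x & Im x <= 3 / 5].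

Lemma csq_near z : insq false z -> near_sq z.
Proof. by move=> /csqP[? ? ? ?]; split; lra. Qed.

Lemma near_csq z x : insq false z -> Normc.normc (x - z) <= 1 / 10 -> near_sq x.
Proof.
move=> /csqP[? ? ? ?] h.
have := le_trans (normc_Re _) h; have := le_trans (normc_Im _) h.
by rewrite !reimE !ler_norml => /andP[? ?] /andP[? ?]; split; lra.
Qed.

Lemma center_cases c : gauss_int c -> [\/ c = 0, gcenter c | 2 < n2 c].
Proof.
move=> gc; have nc := gauss_n2 gc.
have [h|h] := ltP (n2 c) 1.
  constructor 1; apply/eqP; rewrite -n2_eq0; apply/eqP/le_anti; rewrite n2_ge0 andbT.
  exact: int_lt1.
have [h2|h2] := ltP 2 (n2 c); first by constructor 3.
constructor 2; split=> //.
have [h1|h1] := ltP (n2 c) 2; [left|by right; apply/le_anti; rewrite h2].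
by apply/le_anti; rewrite h andbT; apply: int_ltD; rewrite ?rpred1//; lra.
Qed.

Lemma sqr_gt1 (a : R) : 1 < a \/ a < -1 -> 1 < a ^+ 2.
Proof. by case=> ?; nra. Qed.

Lemma gauss_big c : gauss_int c -> 2 < n2 c ->
  [\/ Re c <= -2, 2 <= Re c, Im c <= -2 | 2 <= Im c].
Proof.
move=> [ai bi] h.
have [a1|a1] := leP (Re c) (-2); first by constructor 1.
have [a2|a2] := leP 2 (Re c); first by constructor 2.
have [b1|b1] := leP (Im c) (-2); first by constructor 3.
have [b2|b2] := leP 2 (Im c); first by constructor 4.
exfalso; move: h; rewrite /n2.
by case: (int_cases ai a1 a2) => ->; case: (int_cases bi b1 b2) => ->;
  rewrite ?sqrrN ?expr1n ?expr0n /=; lra.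
Qed.

Lemma far_center c x : gauss_int c -> 2 < n2 c -> near_sq x -> 1 < n2 (x - c).
Proof.
move=> gc h [x1 x2 x3 x4]; rewrite /n2; have [hc|hc|hc|hc] := gauss_big gc h.
- by apply: ltr_wpDr (sqr_gt1 _); rewrite ?sqr_ge0// !reimE; lra.
- by apply: ltr_wpDr (sqr_gt1 _); rewrite ?sqr_ge0// !reimE; lra.
- by apply: ltr_wpDl (sqr_gt1 _); rewrite ?sqr_ge0// !reimE; lra.
- by apply: ltr_wpDl (sqr_gt1 _); rewrite ?sqr_ge0// !reimE; lra.
Qed.

Lemma lteW b (r s : R) : r < s -> lte b r s.
Proof. by case: b => //= /ltW. Qed.

(** The image of a cylinder under [T^n] contains the open tile and lies in the closed one. This
    sandwich avoids describing the half-open boundary left by the floor. *)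
Definition tile b S z := insq b z /\ forall c, S c -> lte b 1 (n2 (z - c)).

(** In the coordinate [w = d + t] the sides of the square become unit circles about units, and a
    circle about [c] with [n2 c = 2] moves to the conjugate centre. Discs with [n2 c = 1] become
    half-planes and give nothing new. *)
Definition shift_centers S d : set R[i] :=
  [set e | gcenter e /\ (gunit (e + d) \/ S (e + d)^*%C)].

(** A disc with [n2 c = 1] turns into the half-plane [Re (c t) <= 1/2 - Re (c d)]; as [Re (c d)] is
    an integer, it contains the square or misses its interior. In the second clause, equality would
    put the removed disc about [t = 0], where it covers the square. *)
Definition admissible S d :=
  (forall c, S c -> n2 c = 1 -> Re (c * d) <= 0) /\
  (forall c, S c -> n2 c = 2 -> d <> c^*%C).

Lemma digit_shift_neq0 d t : 2 <= n2 d -> insq false t -> d + t != 0.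
Proof.
move=> d2 /csq_n2 h; apply/eqP => e.
have {}e : t = - d by apply/eqP; rewrite -addr_eq0 addrC e.
by move: h; rewrite e n2N; lra.
Qed.

Lemma tile_shift S d t : S `<=` gcenter -> d + t != 0 -> insq false t ->
  tile false S (d + t)^-1 -> tile false (shift_centers S d) t.
Proof.
move=> SE w0 ct [sq cs]; split=> // e [ce he].
have key : gunit (e + d) -> lte false 1 (n2 (t - e)).
  move=> ue; have := sq _ ue; rewrite inv_half//; last by case: ue.
  by rewrite (_ : d + t - (e + d) = t - e)//; ring.
case: he => [//|Se]; have [g [c1|c2]] := SE _ Se.
  by apply: key; split; [rewrite -[e + d]conjcK; exact: gaussJ|rewrite -n2J].
have := cs _ Se; rewrite inv_diag// conjcK.
by rewrite (_ : d + t - (e + d) = t - e)//; ring.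
Qed.

(** Each wall to be checked is a unit circle about some [e - d] in the coordinate [t]. The case
    [e = d] is excluded by the size of [d] or by admissibility, centres with [2 < n2] are too far
    away, and the rest belong to [shift_centers]. *)
Lemma tile_unshift b S d t : S `<=` gcenter -> gauss_int d -> 2 <= n2 d ->
  admissible S d -> tile b (shift_centers S d) t -> tile b S (d + t)^-1.
Proof.
move=> SE gd d2 [adm1 adm2] [sq cs].
have csq : insq false t by case: b sq {cs} => // /osq_csq.
have w0 := digit_shift_neq0 d2 csq.
have key e : gauss_int e -> e != d -> (gunit e \/ S e^*%C) -> lte b 1 (n2 (d + t - e)).
  move=> ge ed he; have -> : d + t - e = t - (e - d) by ring.
  have [/eqP|ce|h] := center_cases (gaussB ge gd).
  - by rewrite subr_eq0 (negbTE ed).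
  - by apply: cs; split=> //; rewrite subrK.
  - by apply/lteW/far_center => //; [exact: gaussB|exact: csq_near].
split=> [u gu|c Sc].
  rewrite inv_half//; last by case: gu.
  apply: key; [by case: gu| |by left].
  by apply/eqP => e; case: gu => _; rewrite e => h; move: d2; lra.
have [gc [c1|c2]] := SE _ Sc.
  rewrite inv_unit// mulrDr ReAdd.
  have := sq c (conj gc c1); have := adm1 _ Sc c1.
  by clear; rewrite /lte; case: b; lra.
rewrite inv_diag//; apply: key; [exact: gaussJ| |by right; rewrite conjcK].
by apply/eqP => e; exact: (adm2 _ Sc c2).
Qed.

Lemma tile_admissible S d t : S `<=` gcenter -> gauss_int d -> d + t != 0 -> insq true t ->
  tile false S (d + t)^-1 -> admissible S d.
Proof.
move=> SE gd w0 sq [_ cs]; split=> c Sc c1.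
  have [gc _] := SE _ Sc; have := cs _ Sc; rewrite inv_unit//= mulrDr ReAdd.
  have := sq _ (gunitN (conj gc c1)); rewrite /= mulNr ReOpp => h1 h2.
  by apply: int_lt1; [case: (gaussM gc gd)|lra].
move=> e; have := cs _ Sc; rewrite inv_diag// e [_ + t]addrC addrK /=.
by have /csq_n2 := osq_csq sq; lra.
Qed.

Lemma shift_centers_sub S d : shift_centers S d `<=` gcenter.
Proof. by move=> e []. Qed.

(** By the parallelogram law the two norms add up to at least 6, while each is at most 2. This
    matters at 0, where the discs about [u] and [- u] touch and no direction points strictly out of
    both. *)
Lemma shift_centers_opp S d u : S `<=` gcenter -> gauss_int d -> 2 <= n2 d -> gunit u ->
  shift_centers S d u -> shift_centers S d (- u) -> False.
Proof.
move=> SE gd d2 gu [_ h1] [_ h2].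
have {}h1 : n2 (u + d) = 1 \/ n2 (u + d) = 2.
  by case: h1 => [[_ ->]|/SE[_]]; rewrite ?n2J; auto.
have {}h2 : n2 (- u + d) = 1 \/ n2 (- u + d) = 2.
  by case: h2 => [[_ ->]|/SE[_]]; rewrite ?n2J; auto.
have e : n2 (u + d) + n2 (- u + d) = 2 + 2 * n2 d.
  by case: gu => _ h; rewrite -[X in _ = X + _]mulr1 -[X in _ = _ * X + _]h /n2 !reimE; ring.
by move: e; case: h1 => ->; case: h2 => ->; lra.
Qed.

End Tiles.

(** * Separating lines and circles *)

Section Sep.
Context (R : realType).
Implicit Types z w u c d t x : R[i].

(* Every line [Re (u z) = k + 1/2] and every unit circle centred at a Gaussian
   integer that misses [z] leaves [x] on the same side as [z]. *)
Definition unsep z x :=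
  [/\ forall u k, gunit u -> k \is a Num.int ->
        Re (u * z) < k + 2^-1 -> Re (u * x) < k + 2^-1,
      forall c, gauss_int c -> 1 < n2 (z - c) -> 1 < n2 (x - c)
    & forall c, gauss_int c -> n2 (z - c) < 1 -> n2 (x - c) < 1].

Lemma near_sq_unit u x : gunit u -> near_sq x -> Re (u * x) <= 3 / 5.
Proof. by move=> /gunitP[]-> [? ? ? ?]; rewrite !reimE; lra. Qed.

Lemma near_sq_n2 x : near_sq x -> n2 x < 1.
Proof. by move=> [? ? ? ?]; rewrite /n2; nra. Qed.

(** The map [1 / (d + t)] sends walls near the square to walls; all other walls have the square and
    its enlargement on one side. *)
Lemma unsep_inv d z x : gauss_int d -> d + z != 0 -> d + x != 0 ->
  insq false (d + z)^-1 -> near_sq (d + x)^-1 ->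
  unsep z x -> unsep (d + z)^-1 (d + x)^-1.
Proof.
move=> gd z0 x0 sz nx [sL sO sI]; split.
- move=> u k gu ki; have [u0 u1] := gu.
  have [k0|k0] := leP 1 k; first by have := near_sq_unit gu nx; lra.
  have [k1|k1] := ltP k 0.
    have k2 : k + 1 <= 0 by apply: int_lt1; [rewrite rpredD ?rpred1|lra].
    by have := sz _ (gunitN gu); rewrite /= mulNr ReOpp; lra.
  have -> : k = 0 by apply/le_anti; rewrite k1 andbT; apply: int_lt1.
  rewrite add0r => h; have := @inv_half _ true (d + x) u x0 u1 => /= ->.
  have := @inv_half _ true (d + z) u z0 u1; rewrite /= h => /esym.
  rewrite (_ : d + z - u = z - (u - d)); last by ring.
  rewrite (_ : d + x - u = x - (u - d)); last by ring.
  by apply: sO; exact: gaussB.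
- move=> c gc; have [->|[_ [c1|c1]]|c2] := center_cases gc.
  + by rewrite subr0; have := csq_n2 sz; lra.
  + have := @inv_unit _ true (d + z) c z0 c1 => /= ->.
    have := @inv_unit _ true (d + x) c x0 c1 => /= ->.
    rewrite !mulrDr !ReAdd => h.
    have := @sL c (- Re (c * d)); rewrite rpredN.
    have [h1 _] := gaussM gc gd; move=> /(_ (conj gc c1) h1); lra.
  + have := @inv_diag _ true (d + z) c z0 c1 => /= ->.
    have := @inv_diag _ true (d + x) c x0 c1 => /= ->.
    rewrite (_ : d + z - c^*%C = z - (c^*%C - d)); last by ring.
    rewrite (_ : d + x - c^*%C = x - (c^*%C - d)); last by ring.
    by apply: sO; apply: gaussB => //; exact: gaussJ.
  + by move=> _; exact: far_center.
- move=> c gc; have [->|[_ [c1|c1]]|c2] := center_cases gc.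
  + by rewrite !subr0 => _; exact: near_sq_n2.
  + rewrite !inv_unitI// !mulrDr !ReAdd => h.
    have := @sL (- c) (Re (c * d) - 1); rewrite !mulNr !ReOpp.
    have [h1 _] := gaussM gc gd.
    move=> /(_ (gunitN (conj gc c1))); rewrite rpredB ?rpred1// => /(_ isT); lra.
  + rewrite !inv_diagI//.
    rewrite (_ : d + z - c^*%C = z - (c^*%C - d)); last by ring.
    rewrite (_ : d + x - c^*%C = x - (c^*%C - d)); last by ring.
    by apply: sI; apply: gaussB => //; exact: gaussJ.
  + by have := far_center gc c2 (csq_near sz); lra.
Qed.

(** A matrix rather than a map, because the induction bounds individual entries. *)
Record moeb := Moeb {ma : R[i]; mb : R[i]; mc : R[i]; md : R[i]}.
Implicit Types m : moeb.

Definition den m x := mc m * x + md m.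
Definition mob m x := (ma m * x + mb m) / den m x.
Definition mdet m := ma m * md m - mb m * mc m.

Definition gmoeb m := [/\ gauss_int (ma m), gauss_int (mb m), gauss_int (mc m),
  gauss_int (md m) & n2 (mdet m) = 1].

Lemma gauss_det m : gmoeb m -> gunit (mdet m).
Proof. by case=> ? ? ? ? h; split=> //; apply: gaussB; exact: gaussM. Qed.

Lemma mob_sub m x y : den m x != 0 -> den m y != 0 ->
  mob m x - mob m y = mdet m * (x - y) / (den m x * den m y).
Proof.
rewrite /mob /mdet => h1 h2; rewrite /den in h1 h2 *.
by field; apply/andP.
Qed.

Definition rotm u m := Moeb (u * ma m) (u * mb m) (mc m) (md m).

Lemma mob_rot u m x : mob (rotm u m) x = u * mob m x.
Proof. by rewrite /mob /den /= -mulrA -mulrDr mulrA. Qed.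

Lemma gmoeb_rot u m : gunit u -> gmoeb m -> gmoeb (rotm u m).
Proof.
move=> gu [? ? ? ? h]; have [g1 g2] := gu; split=> //=; try exact: gaussM.
by rewrite /mdet /= -mulrA -[u * mb m * _]mulrA -mulrBr n2M g2 mul1r.
Qed.

(* A Moebius map with [|mc| = 1] is an inversion in the unit circle centred at
   its pole, followed by a Euclidean isometry. *)
Lemma mob_pole m x : gmoeb m -> n2 (mc m) = 1 ->
  x - (- md m * (mc m)^*%C) != 0 ->
  mob m x = ma m * (mc m)^*%C +
    (- mdet m * (mc m)^*%C ^+ 2) * (x - (- md m * (mc m)^*%C))^-1.
Proof.
move=> [_ _ gc _ _] c1 x0; have cc := gunitMJ (conj gc c1).
have c0 : mc m != 0 by rewrite -n2_gt0 c1.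
have -> : (mc m)^*%C = (mc m)^-1 by rewrite -gunitV//; split.
rewrite -(gunitV (conj gc c1)) in x0.
rewrite /mob /den /mdet; field; rewrite c0 /=.
by rewrite (_ : x * mc m - - md m = mc m * (x - - md m / mc m)) ?mulf_neq0//; field.
Qed.

Lemma n2_cases c : gauss_int c -> n2 c <= 1 -> c = 0 \/ n2 c = 1.
Proof. by move=> gc h; case: (center_cases gc) => [->|[_ []]|]; auto; lra. Qed.

(** The condition on [den m z] puts [z] on the isometric circle of [m], the unit circle about its
    pole; [x] then keeps distance at least 9/10 from the pole. *)
Lemma pole_bound m z x : gmoeb m -> n2 (mc m) = 1 -> n2 (den m z) = 1 ->
  Normc.normc (x - z) <= 1 / 10 ->
  n2 (z - (- md m * (mc m)^*%C)) = 1 /\ 4 / 5 <= n2 (x - (- md m * (mc m)^*%C)).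
Proof.
move=> [_ _ gc _ _] c1 dz xz.
have e y : den m y = mc m * (y - (- md m * (mc m)^*%C)).
  rewrite /den -[in LHS](mulr1 (md m)) -(gunitMJ (conj gc c1)); ring.
have h : n2 (z - (- md m * (mc m)^*%C)) = 1 by rewrite -dz e n2M c1 mul1r.
split=> //; set c := - md m * _ in h *.
have hz : Normc.normc (z - c) = 1.
  by apply/eqP; rewrite -(@eqrXn2 _ 2)// ?normc_ge0// -n2_normc h expr1n.
have := normc_tri z c x; rewrite hz normcB => hx.
by rewrite n2_normc; have := normc_ge0 (x - c); nra.
Qed.

Lemma Re_le_n2 w : n2 w < 9 / 4 -> - (3 / 2) < Re w /\ Re w < 3 / 2.
Proof. by rewrite /n2 => h; have := sqr_ge0 (Im w); split; nra. Qed.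

(** In the affine case a line pulls back to a line. In the inversion case, with pole [c] and shifted
    offset [mm], it pulls back to a unit circle through [c] when [mm] is 0 or -1. Other offsets are
    decided by size, since [z] is at distance 1 from [c] and [x] nearly so. *)
Lemma mob_line m z x k : gmoeb m -> n2 (mc m) <= 1 -> n2 (den m z) = 1 ->
  Normc.normc (x - z) <= 1 / 10 -> unsep z x -> k \is a Num.int ->
  k + 2^-1 < Re (mob m z) -> k + 2^-1 < Re (mob m x).
Proof.
move=> gm c1 dz xz [sL sO sI] ki; have [ga gb gc gd det] := gm.
have [c0|{}c1] := n2_cases gc c1.
  have d1 : gunit (md m) by move: dz; rewrite /den c0 mul0r add0r; split.
  have a1 : n2 (ma m) = 1.
    by move: det; rewrite /mdet c0 mulr0 subr0 n2M; case: d1 => _ ->; rewrite mulr1.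
  have e y : mob m y = (ma m * (md m)^*%C) * y + mb m * (md m)^*%C.
    by rewrite /mob /den c0 mul0r add0r gunitV//; ring.
  rewrite !e !ReAdd => h.
  have gv : gunit (- (ma m * (md m)^*%C)).
    by apply: gunitN; apply: gunitM; [split|exact: gunitJ].
  have [hi _] := gaussM gb (gaussJ gd).
  have := @sL _ (Re (mb m * (md m)^*%C) - k - 1) gv.
  rewrite !rpredB ?rpred1// !mulNr !ReOpp => /(_ isT); lra.
have [p1 p2] := pole_bound gm c1 dz xz.
have nz y : 4 / 5 <= n2 (y - - md m * (mc m)^*%C) -> y - - md m * (mc m)^*%C != 0.
  by move=> h; rewrite -n2_gt0; lra.
have z0 : z - - md m * (mc m)^*%C != 0 by apply: nz; lra.
have x0 := nz _ p2.
rewrite !mob_pole// !ReAdd.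
have gc0 : gauss_int (- md m * (mc m)^*%C) by apply: gaussM (gaussN gd) (gaussJ gc).
have gk : gunit (- mdet m * (mc m)^*%C ^+ 2).
  by rewrite expr2; do !apply: gunitM; try apply: gunitJ; [exact/gunitN/gauss_det|split|split].
have [gei _] := gaussM ga (gaussJ gc).
move: (- md m * _) (- mdet m * _) (ma m * _) gc0 gk gei z0 x0 p1 p2 {nz} => c kp ep gc0 gk gei z0 x0 p1 p2.
have [gk0 gk1] := gk.
have mi : k - Re ep \is a Num.int by rewrite rpredB.
set mm := k - Re ep in mi *.
suff : mm + 2^-1 < Re (kp * (z - c)^-1) -> mm + 2^-1 < Re (kp * (x - c)^-1).
  by rewrite /mm; lra.
have hz : Re (kp * (z - c)^-1) < 3 / 2.
  by apply: (Re_le_n2 _).2; rewrite n2M n2V p1 gk1 invr1; lra.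
have hx : - (3 / 2) < Re (kp * (x - c)^-1).
  apply: (Re_le_n2 _).1; rewrite n2M n2V gk1 mul1r.
  by rewrite -[9 / 4]invrK ltf_pV2 ?posrE; lra.
have [h1|h1] := leP 1 mm; first by lra.
have [h2|h2] := leP mm (-2); first by lra.
have e y : y - c - kp = y - (c + kp) by ring.
have e' y : y - c - - kp = y - (c - kp) by ring.
have [->|h3] : mm = 0 \/ mm = -1.
  by case: (int_cases mi h2) => //; auto; lra.
- have P y : y - c != 0 -> (0 + 2^-1 < Re (kp * (y - c)^-1)) = (n2 (y - (c + kp)) < 1).
    move=> y0; rewrite add0r !real_ltNge ?num_real// -e; congr (~~ _).
    exact: (@inv_half _ false).
  by rewrite !P//; apply: sI; exact: gaussD.
- have P y : y - c != 0 -> (-1 + 2^-1 < Re (kp * (y - c)^-1)) = (1 < n2 (y - (c - kp))).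
    move=> y0; rewrite -e'; have := @inv_half _ true (y - c) (- kp) y0.
    by rewrite n2N => /(_ gk1) /= <-; rewrite mulNr ReOpp; apply/idP/idP; lra.
  by rewrite h3 !P//; apply: sO; exact: gaussB.
Qed.

(** The same reduction, to a disc about [h] in the coordinate [1 / (y - q)]. There [z] lies on the
    unit circle, hence outside the open disc about 0 and outside those with [2 < n2 h]; the
    remaining [h] give a line or a unit circle. *)
Lemma mob_circle m z x c : gmoeb m -> n2 (mc m) <= 1 -> n2 (den m z) = 1 ->
  Normc.normc (x - z) <= 1 / 10 -> unsep z x -> gauss_int c ->
  n2 (mob m z - c) < 1 -> n2 (mob m x - c) < 1.
Proof.
move=> gm c1 dz xz [sL sO sI] gcc; have [ga gb gc gd det] := gm.
have [c0|{}c1] := n2_cases gc c1.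
  have d1 : gunit (md m) by move: dz; rewrite /den c0 mul0r add0r; split.
  have a1 : n2 (ma m) = 1.
    by move: det; rewrite /mdet c0 mulr0 subr0 n2M; case: d1 => _ ->; rewrite mulr1.
  have gv : gunit (ma m * (md m)^*%C) by apply: gunitM; [split|exact: gunitJ].
  have e y : n2 (mob m y - c) =
      n2 (y - (ma m * (md m)^*%C)^*%C * (c - mb m * (md m)^*%C)).
    rewrite -[RHS]mul1r; case: (gv) => _ <-; rewrite -n2M mulrBr mulrA gunitMJ// mul1r.
    by congr n2; rewrite /mob /den c0 mul0r add0r gunitV//; ring.
  rewrite !e; apply: sI; apply: gaussM; last by apply/gaussB/gaussM => //; exact: gaussJ.
  by apply: gaussJ; case: gv.
have [p1 p2] := pole_bound gm c1 dz xz.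
have nz y : 4 / 5 <= n2 (y - - md m * (mc m)^*%C) -> y - - md m * (mc m)^*%C != 0.
  by move=> h; rewrite -n2_gt0; lra.
have z0 : z - - md m * (mc m)^*%C != 0 by apply: nz; lra.
have x0 := nz _ p2.
rewrite !mob_pole//.
have gc0 : gauss_int (- md m * (mc m)^*%C) by apply: gaussM (gaussN gd) (gaussJ gc).
have gk : gunit (- mdet m * (mc m)^*%C ^+ 2).
  by rewrite expr2; do !apply: gunitM; try apply: gunitJ; [exact/gunitN/gauss_det|split|split].
have ge := gaussM ga (gaussJ gc).
move: (- md m * _) (- mdet m * _) (ma m * _) gc0 gk ge z0 x0 p1 p2 {nz} => q kp ep gc0 gk ge z0 x0 p1 p2.
have [gk0 gk1] := gk.
have gh : gauss_int (kp^*%C * (c - ep)) by apply: gaussM (gaussJ gk0) (gaussB gcc ge).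
have e y : n2 (ep + kp * (y - q)^-1 - c) = n2 ((y - q)^-1 - kp^*%C * (c - ep)).
  rewrite -[RHS]mul1r -gk1 -n2M mulrBr mulrA gunitMJ// mul1r; congr n2; ring.
rewrite !e; move: (kp^*%C * _) gh => h gh.
have [->|[_ [h1|h1]]|h2] := center_cases gh.
- by rewrite !subr0 n2V p1 invr1 ltxx.
- rewrite !inv_unitI// !mulrBr !reimE -!ReMul.
  have [hi _] := gaussM gh gc0; move=> hh.
  have := @sL (- h) (- Re (h * q) - 1) (gunitN (conj gh h1)).
  by rewrite rpredB ?rpredN ?rpred1// !mulNr !ReOpp => /(_ isT); lra.
- rewrite !inv_diagI//.
  have e' y : y - q - h^*%C = y - (q + h^*%C) by ring.
  by rewrite !e'; apply: sI; apply: gaussD => //; exact: gaussJ.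
- have hz : n2 (z - q)^-1 = 1 by rewrite n2V p1 invr1.
  move: hz; rewrite /n2 !reimE => hz hlt; exfalso.
  move: (Re (z - q)^-1) (Im (z - q)^-1) hz hlt => r s hz hlt.
  have := sqr_ge0 (r - Re h); have := sqr_ge0 (s - Im h).
  have [r1 r2] : -1 <= r /\ r <= 1 by have := sqr_ge0 s; split; nra.
  have [s1 s2] : -1 <= s /\ s <= 1 by have := sqr_ge0 r; split; nra.
  have sq (a : R) : 1 <= a \/ a <= -1 -> 1 <= a ^+ 2 by case=> ?; nra.
  have [hh|hh|hh|hh] := gauss_big gh h2; move=> ? ?.
  - by have := sq (r - Re h); lra.
  - by have := sq (r - Re h); lra.
  - by have := sq (s - Im h); lra.
  - by have := sq (s - Im h); lra.
Qed.

End Sep.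

(** * Changes of coordinates between neighbouring tiles *)

Section Walk.
Context (R : realType).
Implicit Types z w u c d t x : R[i].
Implicit Types m : moeb R.

(* [w] lies in the orbit of [z] under the symmetries of the square. *)
Definition sqsym z w :=
  (Re w ^+ 2 = Re z ^+ 2 /\ Im w ^+ 2 = Im z ^+ 2) \/
  (Re w ^+ 2 = Im z ^+ 2 /\ Im w ^+ 2 = Re z ^+ 2).

Lemma sqsym_n2 z w : sqsym z w -> n2 w = n2 z.
Proof. by rewrite /n2; case=> -[-> ->]//; rewrite addrC. Qed.

Lemma sqsymV z w : sqsym z w -> sqsym z^-1 w^-1.
Proof.
move=> h; have e := sqsym_n2 h; rewrite /sqsym !ReInv !ImInv !sqrrN !expr_div_n e.
by case: h => -[-> ->]; [left|right].
Qed.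

Lemma sqr_half_bounds (a : R) : a ^+ 2 <= 2^-1 ^+ 2 -> - 2^-1 <= a <= 2^-1.
Proof. by move=> h; rewrite -ler_norml -(@ler_pXn2r _ 2)// ?nnegrE// real_normK ?num_real. Qed.

Lemma sqsym_csq z w : sqsym z w -> insq false z -> insq false w.
Proof.
move=> h /csqP[h1 h2 h3 h4]; apply/csqP.
have [hr hi] : Re z ^+ 2 <= 2^-1 ^+ 2 /\ Im z ^+ 2 <= 2^-1 ^+ 2 by split; nra.
have [/andP[? ?] /andP[? ?]] : - 2^-1 <= Re w <= 2^-1 /\ - 2^-1 <= Im w <= 2^-1.
  by case: h => -[e1 e2]; split; apply: sqr_half_bounds; rewrite ?e1 ?e2.
by [].
Qed.

(** Up to sign, [s - b] and [p] agree modulo 1 and both lie in [[-1/2, 1/2]]. They can differ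
    otherwise only at the endpoints, whose squares coincide, so ties in the choice of [b] do no
    harm. *)
Lemma sqr_shift (s p b d : R) : b \is a Num.int -> d \is a Num.int ->
  - 2^-1 <= p <= 2^-1 -> - 2^-1 <= s - b <= 2^-1 -> s ^+ 2 = (p + d) ^+ 2 ->
  (s - b) ^+ 2 = p ^+ 2.
Proof.
move=> bi di /andP[p1 p2] /andP[s1 s2] /eqP; rewrite eqf_sqr => /orP[]/eqP e; rewrite e in s1 s2 *.
- have h : d - b \is a Num.int by rewrite rpredB.
  have -> : p + d - b = p + (d - b) by ring.
  have [] : [\/ d - b = -1, d - b = 0 | d - b = 1] by apply: int_cases => //; lra.
  + move=> e2; have -> : p = 2^-1 by lra. by rewrite e2; lra.
  + by move=> ->; rewrite addr0.
  + move=> e2; have -> : p = - 2^-1 by lra. by rewrite e2; lra.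
- have h : d + b \is a Num.int by rewrite rpredD.
  have -> : - (p + d) - b = - (p + (d + b)) by ring.
  have [] : [\/ d + b = -1, d + b = 0 | d + b = 1] by apply: int_cases => //; lra.
  + move=> e2; have -> : p = 2^-1 by lra. by rewrite e2; lra.
  + by move=> ->; rewrite addr0 sqrrN.
  + move=> e2; have -> : p = - 2^-1 by lra. by rewrite e2; lra.
Qed.

Lemma sqsym_shift z w b d : gauss_int b -> gauss_int d -> insq false z ->
  insq false (w - b) -> sqsym (d + z) w -> sqsym z (w - b).
Proof.
move=> [b1 b2] [d1 d2] /csqP[z1 z2 z3 z4] /csqP.
rewrite /sqsym !reimE => -[w1 w2 w3 w4] [] [e1 e2]; rewrite ![_ + Re z]addrC ![_ + Im z]addrC in e1 e2.
- by left; split; [apply: sqr_shift e1|apply: sqr_shift e2] => //; apply/andP.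
- by right; split; [apply: sqr_shift e1|apply: sqr_shift e2] => //; apply/andP.
Qed.

(* The change of coordinates between two tiles that meet at the point with
   coordinate [z] in the first one: an isometry to first order at [z], mapping
   [z] to a symmetric point of the square. *)
Definition chart z m := [/\ gmoeb m, n2 (den m z) = 1, sqsym z (mob m z)
  & n2 (mc m) <= 1 \/ z = 0 /\ n2 (mc m) <= 2].

Lemma chart_id z : chart z (Moeb 1 0 0 1).
Proof.
split; rewrite /den /mob /= ?mul0r ?add0r ?n2_1 //=.
- by split; rewrite /= /mdet ?mulr0 ?subr0 ?mulr1 ?n2_1//=; [exact: gauss1|exact: gauss0|exact: gauss0|exact: gauss1].
- by rewrite /den /= mul1r mul0r add0r addr0 divr1; left.
- by left; rewrite n2_0.
Qed.

Lemma mob_idE t : mob (Moeb 1 0 0 1) t = t.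
Proof. by rewrite /mob /den /= mul1r mul0r add0r addr0 divr1. Qed.

Lemma chart_neq0 z m : z != 0 -> chart z m -> n2 (mc m) <= 1.
Proof. by move=> z0 [_ _ _ [//|[e _]]]; rewrite e eqxx in z0. Qed.

Lemma mb_formula m z : den m z != 0 ->
  mb m = mob m z * md m - z * (mdet m / den m z).
Proof. by move=> h; rewrite /mob /mdet; rewrite /den in h *; field. Qed.

Lemma int_le2 (r : R) : r \is a Num.int -> r < 3 -> r <= 2.
Proof. by move=> ri h; apply: int_ltD; rewrite ?rpred_nat//; lra. Qed.

Lemma corner_sqr z : insq false z -> n2 z = 2^-1 -> Re z ^+ 2 = 4^-1 /\ Im z ^+ 2 = 4^-1.
Proof.
move=> /csqP[? ? ? ?]; rewrite /n2 => h.
have h1 : Re z ^+ 2 <= 4^-1 by nra.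
have h2 : Im z ^+ 2 <= 4^-1 by nra.
by split; lra.
Qed.

Lemma sqr_eq_or (a b : R) : a ^+ 2 = b ^+ 2 -> a = b \/ a = - b.
Proof. by move=> /eqP; rewrite eqf_sqr => /orP[]/eqP->; auto. Qed.

Lemma corner_coord z : insq false z -> n2 z = 2^-1 ->
  (Re z = 2^-1 \/ Re z = - 2^-1) /\ (Im z = 2^-1 \/ Im z = - 2^-1).
Proof.
move=> sz nz; have [h1 h2] := corner_sqr sz nz.
by split; apply: sqr_eq_or; rewrite ?h1 ?h2; lra.
Qed.

Lemma sqr_le2 (a : R) : a ^+ 2 <= 2 -> -2 < a /\ a < 2.
Proof. by move=> h; split; rewrite ltNge; apply/negP => h'; nra. Qed.

Lemma center_coord c : gauss_int c -> n2 c = 1 \/ n2 c = 2 ->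
  [\/ Re c = -1, Re c = 0 | Re c = 1] /\ [\/ Im c = -1, Im c = 0 | Im c = 1].
Proof.
move=> [gr gi] hc; have := sqr_ge0 (Re c); have := sqr_ge0 (Im c) => i0 r0.
have [r1 r2] : -2 < Re c /\ Re c < 2 by apply: sqr_le2; case: hc; rewrite /n2; lra.
have [i1 i2] : -2 < Im c /\ Im c < 2 by apply: sqr_le2; case: hc; rewrite /n2; lra.
by split; apply: int_cases.
Qed.

(** At a corner [2 Re z] and [2 Im z] are 1 or -1, so [n2 (z - c)] is 1/2 modulo integers. *)
Lemma corner_circle z c : insq false z -> n2 z = 2^-1 -> gauss_int c -> n2 (z - c) = 1 -> False.
Proof.
move=> sz nz gc; have [hr hi] := corner_coord sz nz.
have e : n2 (z - c) = 2^-1 - (2 * Re z * Re c + 2 * Im z * Im c) + n2 c.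
  by rewrite -nz /n2 !reimE; ring.
move=> h; have [gr gi] := gc.
set a := 2 * Re z * Re c + _ in e; have ai : a - n2 c \is a Num.int.
  rewrite rpredB ?gauss_n2// /a; case: hr => ->; case: hi => ->;
  by rewrite ?mulrN divff// ?mulN1r ?mul1r ?rpredD ?rpredN.
have := int_lt1 ai; have := int_gtN1 ai; lra.
Qed.

(** This preserves the coefficient bound, as [mb] is the [mc] of the next chart. [mb_formula] gives
    [mb = e1 - e2] with [|e1| = |z| |md|], [|e2| = |z|] and [|z|^2 <= 1/2]; integrality of the norm
    does the rest. *)
Lemma chart_mb z m : insq false z -> z != 0 -> chart z m ->
  n2 (mb m) <= 1 \/ n2 z = 2^-1 /\ n2 (mb m) <= 2.
Proof.
move=> sz z0 ch; have mc1 := chart_neq0 z0 ch; have [gm dz sy _] := ch.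
have [ga gb gc gd det] := gm.
have dz0 : den m z != 0 by rewrite -n2_gt0 dz.
set e1 := mob m z * md m; set e2 := z * (mdet m / den m z).
have ne1 : n2 e1 = n2 z * n2 (md m) by rewrite n2M (sqsym_n2 sy).
have ne2 : n2 e2 = n2 z by rewrite !n2M n2V dz det invr1 !mulr1.
have eb : mb m = e1 - e2 by exact: mb_formula.
have z12 := csq_n2 sz; have ib := gauss_n2 gb.
have par : n2 (mb m) + n2 (e1 + e2) = 2 * (n2 e1 + n2 e2).
  by rewrite eb n2_parallelogram.
have p0 := n2_ge0 (e1 + e2).
(* The parallelogram law bounds [n2 (mb m)] by [4 n2 z <= 2]; an integer above 1 therefore forces
   [n2 z = 1/2]. *)
have small : n2 (md m) <= 1 -> n2 (mb m) <= 1 \/ n2 z = 2^-1 /\ n2 (mb m) <= 2.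
  move=> hd; have [?|hb] := leP (n2 (mb m)) 1; first by left.
  have h1 : n2 e1 <= n2 z by rewrite ne1 ler_piMr// n2_ge0.
  have h2 : 2 <= n2 (mb m).
    have : 1 + 1 <= n2 (mb m) by rewrite -lerBrDr int_ltD ?rpredB ?rpred1//; lra.
    lra.
  by right; split; lra.
have [c0|c1] := n2_cases gc mc1.
  by apply: small; move: dz; rewrite /den c0 mul0r add0r => ->.
have zz : Normc.normc (z - z) <= 1 / 10 by rewrite subrr Normc.normc0; lra.
have [pz _] := pole_bound gm c1 dz zz.
have gq : gauss_int (- md m * (mc m)^*%C) by apply: gaussM (gaussN gd) (gaussJ gc).
have nq : n2 (- md m * (mc m)^*%C) = n2 (md m) by rewrite n2M n2N n2J c1 mulr1.
case: (center_cases gq) => [q0|[_ []]|hq]; rewrite ?nq.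
- by move: pz; rewrite q0 subr0; lra.
- by move=> d1; have [|[hz _]] := small ltac:(lra); auto; case: (corner_circle sz hz gq pz).
- move=> d2; left.
  have hb3 : n2 (mb m) < 3.
    have n1 : n2 e1 <= 1 by rewrite ne1 d2; lra.
    have n2' : n2 e2 <= 2^-1 by rewrite ne2.
    have h1 : Normc.normc e1 <= 1 by rewrite normc_le// expr1n.
    (* 72/100 slightly exceeds the square root of 1/2, and [(1 + 72/100)^2 < 3]. *)
    have h2 : Normc.normc e2 <= 72 / 100 by rewrite normc_le; [lra|lra].
    rewrite eb n2_normc; have := le_normcD e1 (- e2); rewrite normcN => h3.
    by have := normc_ge0 (e1 - e2); nra.
  have [|hb1] := leP (n2 (mb m)) 1; first by [].
  have b2 : n2 (mb m) = 2.
    apply/le_anti; rewrite int_le2//=.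
    have : 1 + 1 <= n2 (mb m) by rewrite -lerBrDr int_ltD ?rpredB ?rpred1//; lra.
    lra.
  have [ra _] : gauss_int ((mdet m)^*%C * (mb m * mc m)).
    by apply: gaussM; [apply/gaussJ; case: (gauss_det gm)|apply: gaussM].
  have na := gauss_n2 ga.
  (* Parity excludes the value 2: from [ma md = mdet + mb mc] and [n2 (md m) = 2], an even number
     would equal an odd one. *)
  have odd : 2 * n2 (ma m) = 3 + 2 * Re ((mdet m)^*%C * (mb m * mc m)).
    have -> : 2 * n2 (ma m) = n2 (mdet m + mb m * mc m).
      by rewrite -d2 mulrC -n2M /mdet subrK.
    have -> : 3 = n2 (mdet m) + n2 (mb m) * n2 (mc m) by rewrite det b2 c1; lra.
    by rewrite -n2M; move: (mdet m) (mb m * mc m) => p q; rewrite /n2 !reimE; ring.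
  move: (Re _) odd ra na => r odd ra na.
  have : n2 (ma m) - r <= 1 by apply: int_ltD; rewrite ?rpredB ?rpred1//; lra.
  by lra.
- by have := far_center gq hq (csq_near sz); rewrite pz ltxx.
Qed.

(** The matrix of [t -> 1 / m (1 / (d + t)) - b]: remove the digit [d] in the source and [b] in the
    target. *)
Definition stepm m d b := Moeb (md m - b * mb m)
  (mc m + md m * d - b * (ma m + mb m * d)) (mb m) (ma m + mb m * d).

Lemma gmoeb_step m d b : gauss_int d -> gauss_int b -> gmoeb m -> gmoeb (stepm m d b).
Proof.
move=> gd gb [? ? ? ? h]; split=> //=.
- by apply/gaussB/gaussM.
- by apply: gaussB; [apply/gaussD/gaussM|apply/gaussM/gaussD/gaussM].
- by apply/gaussD/gaussM.
- by rewrite -h /mdet /=; congr n2; ring.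
Qed.

Lemma den_step m d b t : d + t != 0 ->
  den (stepm m d b) t = (d + t) * (ma m * (d + t)^-1 + mb m).
Proof. by move=> h; rewrite /den /=; field. Qed.

Lemma mob_step m d b t : d + t != 0 -> den (stepm m d b) t != 0 ->
  mob (stepm m d b) t = (mob m (d + t)^-1)^-1 - b.
Proof.
move=> h1 h2; have h3 : ma m + mb m * (d + t) != 0.
  by move: h2; rewrite /den /= (_ : mb m * t + _ = ma m + mb m * (d + t))//; ring.
have e : mob m (d + t)^-1 = (ma m + mb m * (d + t)) / (mc m + md m * (d + t)).
  rewrite /mob /den.
  have -> : ma m / (d + t) + mb m = (ma m + mb m * (d + t)) / (d + t) by field.
  have -> : mc m / (d + t) + md m = (mc m + md m * (d + t)) / (d + t) by field.
  by rewrite -mulf_div ?invfK divff ?mulr1 ?invr_eq0.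
rewrite e invf_div /mob /=; rewrite /den /= in h2 *; field.
by rewrite h3.
Qed.

Lemma mob_step_inv m d b t : d + t != 0 -> den (stepm m d b) t != 0 ->
  mob m (d + t)^-1 = (b + mob (stepm m d b) t)^-1.
Proof. by move=> h1 h2; rewrite mob_step// [b + _]addrC subrK invrK. Qed.

Lemma den_close m z x : n2 (mc m) <= 2 -> n2 (den m z) = 1 ->
  Normc.normc (x - z) <= 1 / 10 -> 4 / 5 <= Normc.normc (den m x).
Proof.
move=> h hz xz.
have nz : Normc.normc (den m z) = 1.
  by apply/eqP; rewrite -(@eqrXn2 _ 2)// ?normc_ge0// -n2_normc hz expr1n.
have c32 : Normc.normc (mc m) <= 3 / 2 by rewrite normc_le; lra.
have := normc_tri (den m z) 0 (den m x); rewrite !subr0 nz.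
rewrite (_ : den m z - den m x = mc m * (z - x)); last by rewrite /den; ring.
rewrite Normc.normcM [Normc.normc (z - x)]normcB.
have := normc_ge0 (mc m); have := normc_ge0 (x - z); nra.
Qed.

(** The inverse of a corner is a Gaussian integer of norm 2, so [z1] is a Gaussian integer inside
    the closed square. *)
Lemma inv_corner z1 d : gauss_int d -> d + z1 != 0 -> insq false z1 ->
  insq false (d + z1)^-1 -> n2 (d + z1)^-1 = 2^-1 -> z1 = 0.
Proof.
move=> gd w0 s1 sz nz; have [hr hi] := corner_coord sz nz.
set z := (d + z1)^-1 in nz hr hi sz.
have zi : d + z1 = z^-1 by rewrite invrK.
have [er ei] : Re d + Re z1 = 2 * Re z /\ Im d + Im z1 = - 2 * Im z.
  have -> : Re d + Re z1 = Re (d + z1) by rewrite ReAdd.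
  have -> : Im d + Im z1 = Im (d + z1) by rewrite ImAdd.
  by rewrite zi ReInv ImInv nz; split; lra.
have [dr di] := gd; move/csqP: s1 => [? ? ? ?].
have int0 (a : R) : a \is a Num.int -> - 2^-1 <= a <= 2^-1 -> a = 0.
  move=> ai /andP[a1 a2]; have := int_lt1 ai; have := int_gtN1 ai; lra.
apply: complexP; rewrite !reimE; apply: int0.
- have -> : Re z1 = 2 * Re z - Re d by lra.
  by rewrite rpredB//; case: hr => ->; rewrite ?mulrN divff ?rpredN ?rpred1//; lra.
- by apply/andP.
- have -> : Im z1 = - 2 * Im z - Im d by lra.
  by rewrite rpredB//; case: hi => ->; rewrite ?mulrN ?mulNr divff ?rpredN ?rpred1 ?opprK ?rpred1//; lra.
- by apply/andP.
Qed.

(* The [b] below is the digit chosen by the point [x]; the line test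
   [mob_line] shows that [z] would choose it too, up to the boundary. *)
Lemma chart_step z1 x1 d b m : gauss_int d -> d + z1 != 0 -> d + x1 != 0 ->
  insq false z1 -> insq false (d + z1)^-1 ->
  Normc.normc (x1 - z1) <= 1 / 10 -> unsep z1 x1 ->
  chart (d + z1)^-1 m -> gauss_int b ->
  insq false ((mob m (d + x1)^-1)^-1 - b) ->
  chart z1 (stepm m d b) /\
  (forall t, Normc.normc (t - z1) <= 1 / 10 -> den (stepm m d b) t != 0).
Proof.
move=> gd w0 w1 s1 sz xz us ch gb sx.
have z0 : (d + z1)^-1 != 0 by rewrite invr_eq0.
have mc1 := chart_neq0 z0 ch; have [gm dz sy _] := ch.
have d1 : n2 (den (stepm m d b) z1) = 1.
  rewrite den_step// n2M.
  have -> : ma m / (d + z1) + mb m = mob m (d + z1)^-1 * den m (d + z1)^-1.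
    by rewrite /mob divfK// -n2_gt0 dz.
  by rewrite n2M dz mulr1 (sqsym_n2 sy) -n2M divff ?n2_1.
have hb : n2 (mb m) <= 1 \/ z1 = 0 /\ n2 (mb m) <= 2.
  have [|[hz hb]] := chart_mb sz z0 ch; first by left.
  by right; split=> //; exact: inv_corner gd w0 s1 sz hz.
have hb2 : n2 (mb m) <= 2 by case: hb => [|[]]//; lra.
have nd t : Normc.normc (t - z1) <= 1 / 10 -> den (stepm m d b) t != 0.
  move=> /(den_close (m := stepm m d b) hb2 d1) h.
  by rewrite -normc_gt0; lra.
have g' := gmoeb_step gd gb gm.
have dz1 : den (stepm m d b) z1 != 0 by rewrite -n2_gt0 d1.
have ex := mob_step w1 (nd _ xz); have ez := mob_step w0 dz1.
split=> //; split=> //; rewrite ez.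
have sqz : insq false (mob (stepm m d b) z1).
  move=> u gu; rewrite /= leNgt; apply/negP => hlt.
  have hx : Re (u * mob (stepm m d b) x1) <= 2^-1 by rewrite ex; exact: sx.
  case: hb => [hb|[z10 hb]].
    have := @mob_line _ (rotm u (stepm m d b)) z1 x1 0 (gmoeb_rot gu g') hb d1 xz us.
    by rewrite rpred0 !mob_rot !add0r => /(_ isT hlt); lra.
  (* In the exceptional case 0 has a Gaussian integer as image, and the image of [x1] is within 1/8
     of it; so the image of 0 cannot be beyond a side of the square. *)
  have gz : gauss_int (u * mob (stepm m d b) z1).
    apply: gaussM; first by case: gu.
    have [? ? ? ? ?] := g'; rewrite /mob; apply: gaussM.
      by rewrite z10 mulr0 add0r.
    have gdn : gauss_int (den (stepm m d b) z1) by rewrite z10 /den mulr0 add0r.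
    by rewrite gunitV; [exact: gaussJ|split].
  have : Re (u * mob (stepm m d b) z1) <= 0.
    apply: int_lt1; first by case: gz.
    have : Re (u * (mob (stepm m d b) z1 - mob (stepm m d b) x1)) < 2^-1.
      apply: le_lt_trans (le_trans (ler_norm _) (normc_Re _)) _.
      have x4 := den_close (m := stepm m d b) hb d1 xz.
      rewrite normc_lt; last lra.
      have [_ _ _ _ det] := g'.
      rewrite mob_sub//; last exact: nd.
      rewrite n2M; case: gu => _ ->; rewrite !n2M n2V n2M d1 det !mul1r.
      have : n2 (z1 - x1) <= (1/10) ^+ 2 by rewrite -normc_le; [rewrite normcB|lra].
      have : (4/5) ^+ 2 <= n2 (den (stepm m d b) x1).
        by rewrite n2_normc ler_pXn2r ?nnegrE ?normc_ge0//; lra.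
      move: (n2 (z1 - x1)) (n2 (den _ _)) => p q hq hp.
      by rewrite ltr_pdivrMr; nra.
    by rewrite mulrBr ReAdd ReOpp; lra.
  lra.
apply: (sqsym_shift gb gd s1).
  by rewrite -ez.
by rewrite -[X in sqsym X]invrK; exact: sqsymV.
Qed.

End Walk.

(** * Expansions and inverse branches *)

Section Dynamics.
Context (R : realType).
Implicit Types z w u c d t x y v s : R[i].
Implicit Types m : moeb R.
Implicit Types a b : seq R[i].
Implicit Types S : set R[i].
Local Notation T := (@hurwitz_map R).

Lemma nearest_gauss w : gauss_int (nearest w).
Proof. exact: gauss_mk. Qed.

Lemma floor_half_eq0 (r : R) :
  (Num.floor (r + 2^-1))%:~R = 0 :> R <-> - 2^-1 <= r /\ r < 2^-1.
Proof.
split=> [h|[h1 h2]].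
  by have := floor_itv (r + 2^-1); rewrite intrD h add0r => /andP[]; split; lra.
rewrite (@floor_def _ _ 0)// add0r; apply/andP; split; rewrite ?mulr0z ?mulr1z; lra.
Qed.

Lemma hsquareP z : hsquare z <->
  [/\ - 2^-1 <= Re z, Re z < 2^-1, - 2^-1 <= Im z & Im z < 2^-1].
Proof.
rewrite /hsquare /= /nearest; split.
  by move=> [/floor_half_eq0[? ?] /floor_half_eq0[? ?]].
by move=> [? ? ? ?]; apply: complexP => /=; apply/floor_half_eq0.
Qed.

Lemma hsquare_sub w : hsquare (w - nearest w).
Proof.
apply/hsquareP; rewrite !reimE /=.
have := floor_itv (Re w + 2^-1); have := floor_itv (Im w + 2^-1).
by rewrite !intrD => /andP[? ?] /andP[? ?]; split; lra.
Qed.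

Lemma nearestE d t : gauss_int d -> hsquare t -> nearest (d + t) = d.
Proof.
move=> [/intrP[m em] /intrP[n en]]; rewrite /hsquare /= /nearest => -[h1 h2].
have h1' : Num.floor (Re t + 2^-1) = 0 by apply/(@intr_inj R).
have h2' : Num.floor (Im t + 2^-1) = 0 by apply/(@intr_inj R).
apply: complexP; rewrite !reimE /= ?em ?en -addrA floorDzr ?intr_int// intrKfloor.
  by rewrite h1' addr0.
by rewrite h2' addr0.
Qed.

Lemma hsquare_csq z : hsquare z -> insq false z.
Proof. by move/hsquareP => [? ? ? ?]; apply/csqP; split=> //; apply: ltW. Qed.

Lemma osq_hsquare z : insq true z -> hsquare z.
Proof. by move/osqP => [? ? ? ?]; apply/hsquareP; split=> //; apply: ltW. Qed.

Definition digit d := gauss_int d /\ 2 <= n2 d.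
Definition digits a := forall d, d \in a -> digit d.

Lemma digits_cons d a : digits (d :: a) -> digit d /\ digits a.
Proof.
by move=> h; split=> [|e he]; apply: h; rewrite inE ?eqxx// he orbT.
Qed.

Lemma digit_neq0 d t : digit d -> insq false t -> d + t != 0.
Proof. by case=> _; exact: digit_shift_neq0. Qed.

Fixpoint expansion n y := if n is n'.+1 then nearest y^-1 :: expansion n' (T y) else [::].

Lemma size_expansion n y : size (expansion n y) = n.
Proof. by elim: n y => //= n IH y; rewrite IH. Qed.

Lemma nth_expansion n y j : (j < n)%N -> nth 0 (expansion n y) j = partial_quotient j y.
Proof.
elim: n y j => // n IH y [|j] //= jn.
by rewrite IH// /partial_quotient -iterSr.
Qed.

Lemma nearest0 : nearest (0 : R[i]) = 0.
Proof. by apply/hsquareP; rewrite !reimE; split; lra. Qed.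

Lemma expansion_neq0 n y : digits (expansion n.+1 y) -> y != 0.
Proof.
move=> /= /digits_cons[[_ h] _]; apply/eqP => y0.
by move: h; rewrite y0 invr0 nearest0 n2_0; lra.
Qed.

Lemma hurwitz_map_neq0 y : y != 0 -> T y = y^-1 - nearest y^-1.
Proof. by rewrite /hurwitz_map => /negbTE->. Qed.

Lemma hurwitz_map_shift y : y != 0 -> nearest y^-1 + T y = y^-1.
Proof. by move=> y0; rewrite hurwitz_map_neq0// addrC subrK. Qed.

Lemma hurwitz_map_hsquare y : hsquare (T y).
Proof.
rewrite /hurwitz_map; case: eqP => _; last exact: hsquare_sub.
by apply/hsquareP; rewrite !reimE; split; lra.
Qed.

Fixpoint branch a t := if a is d :: a' then (d + branch a' t)^-1 else t.

Lemma branch_expansion n y : digits (expansion n y) ->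
  branch (expansion n y) (iter n T y) = y.
Proof.
elim: n y => [//|n IH] y h; have y0 := expansion_neq0 h.
rewrite iterSr /= IH ?hurwitz_map_shift ?invrK//.
by have [] := digits_cons h.
Qed.

Lemma inv_in_branch d t : hsquare t -> digit d ->
  nearest ((d + t)^-1)^-1 = d /\ T (d + t)^-1 = t.
Proof.
move=> ht hd; have dt := digit_neq0 hd (hsquare_csq ht).
have e : nearest (d + t) = d by apply: nearestE => //; case: hd.
by rewrite hurwitz_map_neq0 ?invr_eq0// invrK e addrAC subrr add0r.
Qed.

(** Only closed conditions, so that a limit point on the boundary qualifies even if the floor would
    give it other digits than [a]. *)
Definition fchain a v := forall k, insq false (branch (drop k a) v).

Lemma fchain_cons d a v : fchain (d :: a) v -> insq false (d + branch a v)^-1 /\ fchain a v.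
Proof. by move=> h; split; [exact: (h 0)|move=> k; exact: (h k.+1)]. Qed.

Lemma fchain0 a v : fchain a v -> insq false (branch a v).
Proof. by move=> /(_ 0); rewrite drop0. Qed.

Lemma fchain_expansion n y : hsquare y -> digits (expansion n y) ->
  fchain (expansion n y) (iter n T y).
Proof.
elim: n y => [|n IH] y hy h [|k] /=; try exact: hsquare_csq.
  by have := branch_expansion h => /= ->; exact: hsquare_csq.
rewrite -iterS iterSr; apply: IH; first exact: hurwitz_map_hsquare.
by have [] := digits_cons h.
Qed.

Lemma normc_csq z : insq false z -> Normc.normc z <= 3 / 4.
Proof. by move=> /csq_n2 h; rewrite normc_le; lra. Qed.

Lemma inv_diff x z : x != 0 -> z != 0 ->
  Normc.normc (x^-1 - z^-1) = Normc.normc (x - z) / (Normc.normc x * Normc.normc z).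
Proof.
move=> x0 z0; rewrite -Normc.normcM -Normc.normcV -Normc.normcM normcB; congr Normc.normc.
by field; rewrite x0 z0.
Qed.

(** The denominators have modulus at least 4/3 along the chain of [v], hence at least 1 along that
    of [t]. One radius 1/10 therefore serves words of every length. *)
Lemma branch_near a v t : digits a -> fchain a v -> Normc.normc (t - v) <= 1 / 10 ->
  Normc.normc (branch a t - branch a v) <= Normc.normc (t - v).
Proof.
move=> + + tv; elim: a => [//|d a IH] /digits_cons[hd ha] /fchain_cons[sq fa] /=.
have h := IH ha fa; have v0 := digit_neq0 hd (fchain0 fa).
have vn : 4 / 3 <= Normc.normc (d + branch a v).
  have := normc_csq sq; rewrite Normc.normcV.
  by rewrite -[3 / 4]invrK lef_pV2 ?posrE ?normc_gt0//; lra.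
have tn : 1 <= Normc.normc (d + branch a t).
  have := normc_tri (d + branch a v) 0 (d + branch a t).
  rewrite !subr0 (_ : d + branch a v - (d + branch a t) = branch a v - branch a t); last by ring.
  by rewrite normcB; lra.
have t0 : d + branch a t != 0 by rewrite -normc_gt0; lra.
rewrite inv_diff// (_ : d + branch a t - (d + branch a v) = branch a t - branch a v); last by ring.
apply: le_trans h; rewrite ler_pdivrMr; last by apply: mulr_gt0; lra.
by rewrite ler_peMr ?normc_ge0//; nra.
Qed.

Lemma branch_near_sq a v t : digits a -> fchain a v -> Normc.normc (t - v) <= 1 / 10 ->
  near_sq (branch a t).
Proof.
move=> ha fa h; apply: near_csq (fchain0 fa) _.
exact: le_trans (branch_near ha fa h) h.
Qed.

Lemma branch_neq0 d a v t : digits (d :: a) -> fchain (d :: a) v ->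
  Normc.normc (t - v) <= 1 / 10 -> d + branch a t != 0.
Proof.
move=> /digits_cons[[_ hd] ha] /fchain_cons[_ fa] h; have := near_sq_n2 (branch_near_sq ha fa h).
move=> lt1; apply/eqP => e; have : branch a t = - d.
  by apply/eqP; rewrite -addr_eq0 addrC e.
by move=> e'; move: lt1; rewrite e' n2N; lra.
Qed.

Lemma unsep_branch a v t : digits a -> fchain a v -> Normc.normc (t - v) <= 1 / 10 ->
  unsep v t -> unsep (branch a v) (branch a t).
Proof.
move=> + + tv us; elim: a => [//|d a IH] ha fa.
have [hd ha'] := digits_cons ha; have [sq fa'] := fchain_cons fa.
apply: unsep_inv => //; try exact: branch_neq0 ha fa _.
- by case: hd.
- by apply: branch_neq0 ha fa _; rewrite subrr Normc.normc0; lra.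
- exact: branch_near_sq ha fa tv.
- exact: IH.
Qed.

(** [chart_step] is iterated from the outer digit inwards. The single point [t] fixes the digits of
    the second word, yet the last identity holds around [v]: there the two inverse branches differ
    by one Moebius map. *)
Lemma chart_walk a m v t : digits a -> fchain a v -> Normc.normc (t - v) <= 1 / 10 ->
  unsep v t -> chart (branch a v) m -> digits (expansion (size a) (mob m (branch a t))) ->
  exists m', [/\ chart v m', mob m' t = iter (size a) T (mob m (branch a t)) &
    forall t', Normc.normc (t' - v) <= 1 / 10 ->
      mob m (branch a t') = branch (expansion (size a) (mob m (branch a t))) (mob m' t')].
Proof.
move=> + + tv us; elim: a m => [|d a IH] m ha fa ch hb; first by exists m.
have [hd ha'] := digits_cons ha; have [sq fa'] := fchain_cons fa.
have [hdb hb'] := digits_cons hb.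
have vv : Normc.normc (v - v) <= 1 / 10 by rewrite subrr Normc.normc0; lra.
set y := mob m (branch (d :: a) t) in hb hdb hb' *.
have y0 : y != 0 by exact: expansion_neq0 hb.
set b := nearest y^-1 in hdb hb'.
have bt := le_trans (branch_near ha' fa' tv) tv.
have gb : gauss_int b by exact: nearest_gauss.
have [ch' nd] := chart_step (proj1 hd) (branch_neq0 ha fa vv) (branch_neq0 ha fa tv)
  (fchain0 fa') sq bt (unsep_branch ha' fa' tv us) ch gb
  (hsquare_csq (hsquare_sub y^-1)).
have ey : mob (stepm m d b) (branch a t) = T y.
  by rewrite mob_step ?(branch_neq0 ha fa tv)// ?nd// hurwitz_map_neq0.
have hb2 : digits (expansion (size a) (mob (stepm m d b) (branch a t))) by rewrite ey.
have [m' [ch2 e1 e2]] := IH _ ha' fa' ch' hb2.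
exists m'; split=> //; first by rewrite e1 ey -iterSr.
move=> t' tv'; rewrite /= -/b -ey -e2//.
apply: mob_step_inv; first exact: branch_neq0 ha fa tv'.
by apply: nd; exact: le_trans (branch_near ha' fa' tv') tv'.
Qed.

Fixpoint admissible_word S a :=
  if a is d :: a' then admissible S d /\ admissible_word (shift_centers S d) a' else True.

Local Notation state := (foldl (@shift_centers R)).

Lemma tile_expansion n y S : S `<=` @gcenter R -> hsquare y -> digits (expansion n y) ->
  tile false S y -> tile false (state S (expansion n y)) (iter n T y).
Proof.
elim: n y S => [//|n IH] y S SE hy h ty; have y0 := expansion_neq0 h.
rewrite iterSr /=; have [hd h'] := digits_cons h; have hT := hurwitz_map_hsquare y.
apply: IH => //; first exact: shift_centers_sub.
apply: tile_shift => //; try exact: hsquare_csq.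
  by rewrite hurwitz_map_shift// invr_eq0.
by rewrite hurwitz_map_shift// invrK.
Qed.

Lemma tile_branch (e : bool) S a t : S `<=` @gcenter R -> digits a -> admissible_word S a ->
  tile e (state S a) t -> tile e S (branch a t) /\ fchain a t.
Proof.
have cl S' t' : tile e S' t' -> insq false t' by case: (e) => -[h _] //; exact: osq_csq.
elim: a S => [|d a IH] S SE.
  by move=> _ _ /= h; split=> // k; exact: cl h.
move=> /digits_cons[[gd nd] ha] [adm adm'] /= h.
have [h1 h2] := IH _ (@shift_centers_sub _ S d) ha adm' h.
have h3 := tile_unshift SE gd nd adm h1.
by split=> // -[|k]; [exact: cl h3|exact: h2].
Qed.

Lemma expansion_branch a t : digits a -> hsquare t -> (forall k, hsquare (branch (drop k a) t)) ->
  expansion (size a) (branch a t) = a /\ iter (size a) T (branch a t) = t.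
Proof.
elim: a => [//|d a IH] /digits_cons[hd ha] ht h /=.
have h1 : hsquare (branch a t) by have := h 1; rewrite /= drop0.
have [e1 e2] := inv_in_branch h1 hd; have [e3 e4] := IH ha ht (fun k => h k.+1).
by rewrite -iterS iterSr e1 e2 e3.
Qed.

Lemma tile_branch_expansion S a t : S `<=` @gcenter R -> digits a -> admissible_word S a ->
  tile true (state S a) t ->
  [/\ hsquare (branch a t), expansion (size a) (branch a t) = a &
      iter (size a) T (branch a t) = t].
Proof.
move=> SE ha adm h.
have hk : forall k, hsquare (branch (drop k a) t).
  elim: a S SE ha adm h => [|d a IH] S SE.
    by move=> _ _ [h _] k; exact: osq_hsquare.
  move=> ha adm h [|k].
    by have [[h1 _] _] := tile_branch SE ha adm h; exact: osq_hsquare.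
  have [_ ha'] := digits_cons ha.
  exact: (IH _ (@shift_centers_sub _ S d) ha' (proj2 adm) h).
have ht : hsquare t by have [h1 _] := h; exact: osq_hsquare.
have [] := expansion_branch ha ht hk; split=> //.
by have := hk 0; rewrite drop0.
Qed.

(** Off the boundary and off 0 the digits are locally constant, so these points have neighbourhoods
    inside their cylinders. *)
Fixpoint generic n y := insq true y /\ if n is n'.+1 then y != 0 /\ generic n' (T y) else True.

Lemma generic_osq n y : generic n y -> insq true y.
Proof. by case: n => [|n] []. Qed.

(** A digit 0 is impossible since [n2 y^-1 >= 2]. A unit digit is impossible since [y^-1] is at
    distance at least 1 from units, whereas [n2 (T y) <= 1/2]. *)
Lemma generic_digits n y : generic n y -> digits (expansion n y).
Proof.
elim: n y => [//|n IH] y [sq [y0 gT]] /= d; rewrite inE => /orP[/eqP->|]; last exact: IH.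
have gd := nearest_gauss y^-1; split=> //.
have sT := generic_osq gT; have e := hurwitz_map_shift y0.
case: (center_cases gd) => [d0|[_ [d1|->//]]|h]; last exact: ltW.
- have := csq_n2 (osq_csq sT); rewrite -[T y]add0r -d0 e n2V.
  have := csq_n2 (osq_csq sq); rewrite -n2_gt0 in y0 => h1 h2.
  by have := lef_pV2; move: h2; rewrite -[2^-1]invrK in h1 *; rewrite lef_pV2 ?posrE; lra.
- have w0 : nearest y^-1 + T y != 0 by rewrite e invr_eq0.
  have := @inv_half _ false _ _ w0 d1; rewrite e invrK (osq_csq sq (conj gd d1)) /=.
  rewrite -[X in n2 (X - _)]e addrAC subrr add0r => /esym.
  by have := csq_n2 (osq_csq sT); lra.
Qed.

Lemma generic_admissible n y S : S `<=` @gcenter R -> generic n y -> tile false S y ->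
  admissible_word S (expansion n y).
Proof.
elim: n y S => [//|n IH] y S SE [sq [y0 gT]] ty /=.
have gd := nearest_gauss y^-1; have e := hurwitz_map_shift y0.
have w0 : nearest y^-1 + T y != 0 by rewrite e invr_eq0.
have ty' : tile false S (nearest y^-1 + T y)^-1 by rewrite e invrK.
split; first exact: tile_admissible SE gd w0 (generic_osq gT) ty'.
apply: IH => //; first exact: shift_centers_sub.
by apply: tile_shift => //; apply: osq_csq; exact: generic_osq gT.
Qed.

(** Only the last digit matters; the empty word has no centres. *)
Lemma state_no_opp a u : digits a -> gunit u -> state set0 a u -> state set0 a (- u) -> False.
Proof.
elim/last_ind: a => [//|a d _] h gu; rewrite -cats1 foldl_cat /=.
have [gd nd] : digit d by apply: h; rewrite mem_rcons inE eqxx.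
apply: shift_centers_opp => //.
elim/last_ind: (a) => [//|a' d' _] ; rewrite -cats1 foldl_cat /=; exact: shift_centers_sub.
Qed.

Lemma state_sub S a : S `<=` @gcenter R -> state S a `<=` @gcenter R.
Proof. by elim: a S => //= d a IH S SE; apply: IH; exact: shift_centers_sub. Qed.

End Dynamics.

(** * Distortion *)

Section Distortion.
Context (R : realType).
Implicit Types z w u c d t x y v s : R[i].
Implicit Types a b : seq R[i].

(* The inverse of the modulus of the derivative of [T^(size a)] at [branch a w]. *)
Fixpoint bprod a w : R := if a is d :: a' then n2 (branch a w) * bprod a' w else 1.

Lemma bprod_gt0 a w : digits a -> fchain a w -> 0 < bprod a w.
Proof.
elim: a => [//|d a IH] ha fa; have [hd ha'] := digits_cons ha; have [_ fa'] := fchain_cons fa.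
apply: mulr_gt0; last exact: IH.
by rewrite n2_gt0 invr_eq0 (digit_neq0 hd)//; exact: fchain0.
Qed.

Lemma bprod_le a w : digits a -> fchain a w -> bprod a w <= 2^-1 ^+ size a.
Proof.
elim: a => [|d a IH] ha fa; first by rewrite expr0.
have [hd ha'] := digits_cons ha; have [sq fa'] := fchain_cons fa.
rewrite exprS; apply: ler_pM; [exact: n2_ge0|exact/ltW/bprod_gt0|exact: csq_n2 sq|exact: IH].
Qed.

(** A quantitative inverse function statement. The factor [(1 + 2^-n) / 2] decreases from 1 to 1/2,
    and the drop at each digit pays for the relative error of one inversion, at most a quarter of
    [2^-1 ^+ size a] for the remaining word [a]. *)
Lemma branch_surj a w y (eta : R) : 0 <= eta -> eta <= 4^-1 -> digits a -> fchain a w ->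
  Normc.normc (y - branch a w) <= (1 + 2^-1 ^+ size a) / 2 * eta * bprod a w ->
  exists2 t, branch a t = y & Normc.normc (t - w) <= eta.
Proof.
move=> e0 e4; elim: a y => [|d a IH] y ha fa.
  by rewrite /= expr0 mulr1 => h; exists y => //; lra.
have [hd ha'] := digits_cons ha; have [sq fa'] := fchain_cons fa.
have w0 := digit_neq0 hd (fchain0 fa').
have q0 : 0 < 2^-1 ^+ size a :> R by rewrite exprn_gt0.
have q1 : 2^-1 ^+ size a <= 1 :> R by apply: exprn_ile1; lra.
have p0 := bprod_gt0 ha' fa'; have p1 := bprod_le ha' fa'.
rewrite /= exprS n2_normc Normc.normcV.
have zz := normc_csq sq; rewrite Normc.normcV in zz.
have z0 : 0 < (Normc.normc (d + branch a w))^-1 by rewrite invr_gt0 normc_gt0.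
move: (2^-1 ^+ size a) q0 q1 p1 IH => q q0 q1 p1 IH.
set z := (Normc.normc _)^-1 in zz z0 *; set e := Normc.normc (y - _); move: (bprod a w) p0 p1 IH => p p0 p1 IH h.
have k1 : e <= eta * p * z ^+ 2.
  apply: le_trans h _.
  rewrite (_ : _ * (z ^+ 2 * p) = (1 + 2^-1 * q) / 2 * (eta * p * z ^+ 2)); last by ring.
  by rewrite ler_piMl ?mulr_ge0 ?sqr_ge0 ?(ltW p0)//; lra.
have k2 : e <= 4^-1 * z.
  apply: le_trans k1 _; have h1 : eta * p <= 4^-1 by nra.
  have h2 : z ^+ 2 <= z by nra.
  by have := ltW p0; nra.
have y0 : y != 0.
  rewrite -normc_gt0; have := normc_tri (d + branch a w)^-1 0 y.
  by rewrite !subr0 Normc.normcV normcB -/e -/z; lra.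
have ny : z - e <= Normc.normc y.
  have := normc_tri (d + branch a w)^-1 0 y.
  by rewrite !subr0 Normc.normcV normcB -/e -/z; lra.
have [] := IH (y^-1 - d) ha' fa'; last first.
  by move=> t et ht; exists t; rewrite // et addrC subrK invrK.
rewrite (_ : y^-1 - d - branch a w = y^-1 - ((d + branch a w)^-1)^-1); last first.
  by rewrite invrK opprD addrA.
rewrite inv_diff ?invr_eq0// Normc.normcV -/z -/e.
rewrite ler_pdivrMr ?mulr_gt0 ?normc_gt0//.
apply: (@le_trans _ _ ((1 + q) / 2 * eta * p * ((z - e) * z))); last first.
  rewrite ler_wpM2l ?mulr_ge0 ?(ltW p0)//; first by lra.
  by rewrite ler_wpM2r ?(ltW z0).
apply: le_trans h _.
have e5 : e <= eta * p * z * z by rewrite -mulrA -expr2.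
have e6 : eta * p * z <= 4^-1 * q.
  have h1 : p * z <= q by nra.
  by rewrite -mulrA; nra.
rewrite (_ : (1 + 2^-1 * q) / 2 * eta * (z ^+ 2 * p) = (eta * p * z) * ((1 + 2^-1 * q) / 2 * z)); last by ring.
rewrite (_ : (1 + q) / 2 * eta * p * ((z - e) * z) = (eta * p * z) * ((1 + q) / 2 * (z - e))); last by ring.
rewrite ler_wpM2l ?mulr_ge0 ?(ltW p0) ?(ltW z0)//.
have e7 : e <= 4^-1 * q * z by apply: le_trans e5 _; rewrite ler_wpM2r ?(ltW z0).
have e8 : (1 + q) / 2 * e <= 1 * (4^-1 * q * z).
  by apply: ler_pM => //; [lra|exact: normc_ge0|lra].
lra.
Qed.

(** Adding a digit to [a] multiplies the distortion by at most [1 + 2 q <= expR (2 q)] with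
    [q = 2^-1 ^+ size a]; the exponents sum to [4 (1 - q)], bounded by 4. *)
Lemma branch_contract a s w : digits a -> fchain a s -> fchain a w ->
  Normc.normc (s - w) <= 2 ->
  Normc.normc (branch a s - branch a w) <= 2 * 2^-1 ^+ size a /\
  Normc.normc (branch a s - branch a w) <= 2 * expR (4 * (1 - 2^-1 ^+ size a)) * bprod a w.
Proof.
move=> + + + sw; elim: a => [_ _ _|d a IH ha fs fw].
  by rewrite /= expr0 subrr mulr0 expR0 !mulr1.
have [hd ha'] := digits_cons ha; have [sqs fs'] := fchain_cons fs; have [sqw fw'] := fchain_cons fw.
have s0 := digit_neq0 hd (fchain0 fs'); have w0 := digit_neq0 hd (fchain0 fw').
have [h1 h2] := IH ha' fs' fw'.
have ys := normc_csq sqs; have yw := normc_csq sqw.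
set y := (d + branch a s)^-1 in ys *; set z := (d + branch a w)^-1 in yw *.
have e : Normc.normc (y - z) =
    Normc.normc (branch a s - branch a w) * (Normc.normc y * Normc.normc z).
    rewrite inv_diff// invfM -!Normc.normcV; congr (Normc.normc _ * _); ring.
have q0 : 0 < 2^-1 ^+ size a :> R by rewrite exprn_gt0.
have q1 : 2^-1 ^+ size a <= 1 :> R by apply: exprn_ile1; lra.
have p0 := bprod_gt0 ha' fw'.
have y0 := normc_ge0 y; have z0 := normc_ge0 z.
set D := Normc.normc (branch a s - branch a w) in h1 h2 e.
have D0 : 0 <= D by exact: normc_ge0.
have yz : Normc.normc y * Normc.normc z <= 2^-1.
  have := csq_n2 sqs; have := csq_n2 sqw; rewrite -/y -/z !n2_normc.
  have := sqr_ge0 (Normc.normc y - Normc.normc z); nra.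
split.
  rewrite e /= exprS (_ : 2 * (2^-1 * _) = 2 * 2^-1 ^+ size a * 2^-1); last by ring.
  by apply: ler_pM; rewrite ?mulr_ge0.
have ly : Normc.normc y <= Normc.normc z * (1 + 2 * 2^-1 ^+ size a).
  have t := normc_tri y 0 z; rewrite !subr0 e in t.
  have : D * (Normc.normc y * Normc.normc z) <= 2 * 2^-1 ^+ size a * (1 * Normc.normc z).
    by apply: ler_pM; rewrite ?mulr_ge0//; rewrite ler_wpM2r//; lra.
  lra.
have ex : (1 + 2 * 2^-1 ^+ size a) * expR (4 * (1 - 2^-1 ^+ size a)) <=
    expR (4 * (1 - 2^-1 ^+ (size a).+1)) :> R.
  have -> : 4 * (1 - 2^-1 ^+ (size a).+1) = 2 * 2^-1 ^+ size a + 4 * (1 - 2^-1 ^+ size a) :> R.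
    by rewrite exprS; lra.
  by rewrite expRD ler_wpM2r ?expR_ge0// expR_ge1Dx.
rewrite e /= -/z n2_normc.
apply: (@le_trans _ _ (2 * expR (4 * (1 - 2^-1 ^+ size a)) * bprod a w *
    (Normc.normc z * (1 + 2 * 2^-1 ^+ size a) * Normc.normc z))).
  by apply: ler_pM => //; rewrite ?mulr_ge0// ler_wpM2r.
move: ex; move: (expR _) (expR _) => E2 E1 ex.
have g0 : 0 <= Normc.normc z ^+ 2 * bprod a w by rewrite mulr_ge0 ?sqr_ge0 ?ltW.
rewrite [X in X <= _](_ : _ = 2 * ((1 + 2 * 2^-1 ^+ size a) * E1) * (Normc.normc z ^+ 2 * bprod a w)); last by ring.
by rewrite ler_wpM2r// ler_wpM2l.
Qed.

End Distortion.

(** * Local finiteness of the walls *)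

Section Near.
Context (R : realType).
Implicit Types z w u c d t x y v s : R[i].

Lemma eps_seq (I : eqType) (l : seq I) (P : I -> R -> Prop) :
  (forall i e e', P i e -> 0 < e' -> e' <= e -> P i e') ->
  (forall i, i \in l -> exists2 e, 0 < e & P i e) ->
  exists2 e, 0 < e & forall i, i \in l -> P i e.
Proof.
move=> mono; elim: l => [|i l IH] h; first by exists 1.
have [e1 e10 p1] := h i (mem_head _ _).
have [|e2 e20 p2] := IH; first by move=> j hj; apply: h; rewrite inE hj orbT.
have e0 : 0 < Num.min e1 e2 by rewrite lt_min e10.
exists (Num.min e1 e2) => // j; rewrite inE => /orP[/eqP->|hj].
  by apply: mono p1 e0 _; rewrite ge_min lexx.
by apply: mono (p2 _ hj) e0 _; rewrite ge_min lexx orbT.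
Qed.

Definition units : seq R[i] := [:: 1; -1; 'i; - 'i].

Lemma unitsP u : gunit u -> u \in units.
Proof. by move/gunitP => -[]->; rewrite !inE eqxx ?orbT. Qed.

Lemma gunit_units u : u \in units -> gunit u.
Proof.
rewrite !inE => /or4P[]/eqP->; do ?apply: gunitN; by [exact: gunit1|exact: gunitI].
Qed.

Definition centers : seq R[i] := [seq p +i* q | p : R <- [:: -1; 0; 1], q : R <- [:: -1; 0; 1]].

Lemma centersP c : gcenter c -> c \in centers.
Proof.
move=> [gc hc]; have [h1 h2] := center_coord gc hc.
apply/allpairsP; exists (Re c, Im c); rewrite /= !inE; split; last by case: (c).
- by case: h1 => ->; rewrite eqxx ?orbT.
- by case: h2 => ->; rewrite eqxx ?orbT.
Qed.

Lemma normc_gunitM u x : gunit u -> Normc.normc (u * x) = Normc.normc x.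
Proof.
move=> [_ hu]; rewrite Normc.normcM (_ : Normc.normc u = 1) ?mul1r//.
by apply/eqP; rewrite -(@eqrXn2 _ 2)// ?normc_ge0// -n2_normc hu expr1n.
Qed.

Lemma n2_gt1 x : (1 < n2 x) = (1 < Normc.normc x).
Proof. by rewrite n2_normc -[in LHS](expr1n R 2) ltr_pXn2r// ?nnegrE ?normc_ge0. Qed.

Lemma n2_lt1 x : (n2 x < 1) = (Normc.normc x < 1).
Proof. by rewrite normc_lt// expr1n. Qed.

(** Only the nearest line in each of four directions and the circles about nine centres can come
    between [v] and a close point. *)
Lemma unsep_near v : insq false v -> exists r,
  [/\ 0 < r, r <= 1 / 10 & forall x, Normc.normc (x - v) < r -> unsep v x].
Proof.
move=> sv.
have [e1 e10 h1] : exists2 e, 0 < e & forall u, u \in units -> forall x,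
    Normc.normc (x - v) < e -> forall k, k \is a Num.int ->
    Re (u * v) < k + 2^-1 -> Re (u * x) < k + 2^-1.
  apply: eps_seq => [u e e' h e'0 ee' x hx|u hu]; first by apply: h; exact: lt_le_trans ee'.
  (* [f + 1/2] is the lowest half-integer line strictly beyond [v], so its distance from [v] serves
     every [k]. *)
  have /andP[f1 f2] := floor_itv (Re (u * v) + 2^-1); rewrite intrD in f2.
  set f := (Num.floor _)%:~R in f1 f2.
  have fi : f \is a Num.int by rewrite /f intr_int.
  exists (f + 2^-1 - Re (u * v)); first by lra.
  move=> x hx k ki hk; have fk : f <= k by apply: int_ltD => //; lra.
  have := le_lt_trans (le_trans (ler_norm _) (normc_Re (u * (x - v)))).
  move=> /(_ (f + 2^-1 - Re (u * v))); rewrite normc_gunitM; last exact: gunit_units.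
  by move=> /(_ hx); rewrite mulrBr ReAdd ReOpp; lra.
have [e2 e20 h2] : exists2 e, 0 < e & forall c, c \in centers -> forall x,
    Normc.normc (x - v) < e ->
    (1 < n2 (v - c) -> 1 < n2 (x - c)) /\ (n2 (v - c) < 1 -> n2 (x - c) < 1).
  apply: eps_seq => [c e e' h e'0 ee' x hx|c _]; first by apply: h; exact: lt_le_trans ee'.
  have [e|ne] := eqVneq (Normc.normc (v - c)) 1.
    by exists 1 => // x _; rewrite n2_gt1 n2_lt1 e ltxx.
  exists `|Normc.normc (v - c) - 1|; first by rewrite normr_gt0 subr_eq0.
  move=> x; rewrite !n2_gt1 !n2_lt1.
  have := normc_tri v c x; have := normc_tri x c v; rewrite [Normc.normc (v - x)]normcB.
  by move=> t1 t2 hx; split=> hv; move: hx; [rewrite gtr0_norm|rewrite ltr0_norm]; lra.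
exists (Num.min e1 (Num.min e2 (1 / 10))); split; first by rewrite !lt_min e10 e20 /=; lra.
  by rewrite !ge_min lexx !orbT.
move=> x; rewrite !lt_min => /and3P[x1 x2 /ltW x3].
have nx := near_csq sv x3; split.
- by move=> u k gu ki; apply: h1 => //; exact: unitsP.
- move=> c gc; have [->|cc|cc] := center_cases gc.
  + by rewrite subr0; have := csq_n2 sv; lra.
  + exact: (h2 _ (centersP cc) _ x2).1.
  + by move=> _; exact: far_center.
- move=> c gc; have [->|cc|cc] := center_cases gc.
  + by rewrite !subr0 => _; exact: near_sq_n2.
  + exact: (h2 _ (centersP cc) _ x2).2.
  + by have := far_center gc cc (csq_near sv); lra.
Qed.

End Near.

(** * Directions entering a tile *)

Section Directions.
Context (R : realType).
Implicit Types z w u c d t x y v p q th tau om : R[i].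
Implicit Types m : moeb R.
Implicit Types S : set R[i].

Definition points_inside S p tau :=
  (forall u, gunit u -> Re (u * p) = 2^-1 -> Re (u * tau) < 0) /\
  (forall c, S c -> n2 (p - c) = 1 -> 0 < Re ((p - c)^*%C * tau)).

Lemma Re_le_normc x : Re x <= Normc.normc x.
Proof. exact: le_trans (ler_norm _) (normc_Re _). Qed.

Lemma Re_ge_normc x : - Normc.normc x <= Re x.
Proof. by rewrite lerNl -ReOpp -[Normc.normc x]normcN; exact: Re_le_normc. Qed.

Lemma normc_real (r : R) x : 0 <= r -> Normc.normc (r%:C * x) = r * Normc.normc x.
Proof.
move=> r0; rewrite Normc.normcM; congr (_ * _).
by rewrite /Normc.normc /= expr0n addr0 sqrtr_sqr ger0_norm.
Qed.

Lemma Re_scale u (r : R) x : Re (u * (r%:C * x)) = r * Re (u * x).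
Proof. by rewrite !reimE; ring. Qed.

(** Strict inequalities survive a small change of direction. Uniformity in [ka] is needed because
    [mob m] bends a ray into a curve that is only tangent to [tau]. *)
Lemma points_inside_tile S p tau : S `<=` @gcenter R -> tile false S p ->
  points_inside S p tau ->
  exists2 e, 0 < e & forall ka (r : R), Normc.normc (ka - tau) < e -> 0 < r -> r < e ->
    tile true S (p + r%:C * ka).
Proof.
move=> SE [sp cp] [gl gc].
have bnd ka (r e : R) : Normc.normc (ka - tau) < e -> e <= 1 -> 0 < r -> r < e ->
    Normc.normc (r%:C * ka) <= e * (Normc.normc tau + 1).
  move=> h e1 r0 re; rewrite normc_real; last exact: ltW.
  apply: ler_pM; [exact: ltW|exact: normc_ge0|exact: ltW|].
  by have := normc_tri ka 0 tau; rewrite !subr0; lra.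
have T0 : 0 < Normc.normc tau + 1 by have := normc_ge0 tau; lra.
have [e1 e10 h1] : exists2 e, 0 < e & forall u, u \in units R -> forall ka (r : R),
    Normc.normc (ka - tau) < e -> 0 < r -> r < e -> Re (u * (p + r%:C * ka)) < 2^-1.
  apply: eps_seq => [u e e' h e'0 ee' ka r h1 h2 h3|u /gunit_units gu].
    by apply: h => //; [exact: lt_le_trans ee'|exact: lt_le_trans ee'].
  have := sp _ gu; rewrite /= le_eqVlt => /orP[/eqP eu|lu].
    have lt := gl _ gu eu; exists (- Re (u * tau)); first by lra.
    move=> ka r h2 h3 h4; have := Re_le_normc (u * (ka - tau)).
    rewrite normc_gunitM// mulrBr mulrDr !ReAdd ReOpp eu Re_scale; nra.
  have g0 : 0 < (2^-1 - Re (u * p)) / (Normc.normc tau + 1) / 2 by rewrite !divr_gt0//; lra.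
  exists (Num.min 1 ((2^-1 - Re (u * p)) / (Normc.normc tau + 1) / 2)).
    by rewrite lt_min g0 ltr01.
  move=> ka r h2 h3 h4; have := bnd _ _ _ h2 _ h3 h4; rewrite ge_min lexx => /(_ isT) hb.
  have := Re_le_normc (u * (r%:C * ka)); rewrite normc_gunitM// mulrDr ReAdd.
  have : Num.min 1 ((2^-1 - Re (u * p)) / (Normc.normc tau + 1) / 2) * (Normc.normc tau + 1) <= (2^-1 - Re (u * p)) / 2.
    rewrite -ler_pdivlMr// -mulrA [_^-1 * 2^-1]mulrC mulrA ge_min; apply/orP; right.
    by rewrite -!mulrA [2^-1 * _]mulrC.
  lra.
have [e2 e20 h2] : exists2 e, 0 < e & forall c, c \in centers R -> S c -> forall ka (r : R),
    Normc.normc (ka - tau) < e -> 0 < r -> r < e -> 1 < n2 (p + r%:C * ka - c).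
  apply: eps_seq => [c e e' h e'0 ee' Sc ka r h1' h2 h3|c _].
    by apply: h => //; [exact: lt_le_trans ee'|exact: lt_le_trans ee'].
  have [Sc|nSc] := pselect (S c); last by exists 1.
  have ex ka (r : R) : n2 (p + r%:C * ka - c) =
      n2 (p - c) + 2 * r * Re ((p - c)^*%C * ka) + r ^+ 2 * n2 ka.
    by rewrite /n2 !reimE; ring.
  have := cp _ Sc; rewrite /= le_eqVlt => /orP[/eqP ec|lc].
    have lt := gc _ Sc (esym ec); exists (Re ((p - c)^*%C * tau)); first by [].
    move=> _ ka r h2 h3 h4; rewrite ex -ec.
    have := Re_ge_normc ((p - c)^*%C * (ka - tau)).
    rewrite Normc.normcM (_ : Normc.normc (p - c)^*%C = 1); last first.
      by apply/eqP; rewrite -(@eqrXn2 _ 2)// ?normc_ge0// -n2_normc n2J -ec expr1n.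
    rewrite mul1r mulrBr ReAdd ReOpp => h5.
    have h6 : 0 < Re ((p - c)^*%C * ka) by lra.
    have := mulr_ge0 (sqr_ge0 r) (n2_ge0 ka); have := mulr_gt0 h3 h6; nra.
  move: lc; rewrite n2_gt1 => lc.
  have g0 : 0 < (Normc.normc (p - c) - 1) / (Normc.normc tau + 1) / 2 by rewrite !divr_gt0//; lra.
  exists (Num.min 1 ((Normc.normc (p - c) - 1) / (Normc.normc tau + 1) / 2)).
    by rewrite lt_min g0 ltr01.
  move=> _ ka r h2 h3 h4; have := bnd _ _ _ h2 _ h3 h4; rewrite ge_min lexx => /(_ isT) hb.
  rewrite n2_gt1; have := normc_tri p c (p + r%:C * ka).
  rewrite (_ : p - (p + r%:C * ka) = - (r%:C * ka)) ?normcN; last by ring.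
  have : Num.min 1 ((Normc.normc (p - c) - 1) / (Normc.normc tau + 1) / 2) * (Normc.normc tau + 1) <= (Normc.normc (p - c) - 1) / 2.
    rewrite -ler_pdivlMr// -mulrA [_^-1 * 2^-1]mulrC mulrA ge_min; apply/orP; right.
    by rewrite -!mulrA [2^-1 * _]mulrC.
  lra.
exists (Num.min e1 e2); first by rewrite lt_min e10.
move=> ka r; rewrite !lt_min => /andP[k1 k2] r0 /andP[r1 r2]; split.
  by move=> u gu; apply: h1 => //; exact: unitsP.
by move=> c Sc; apply: h2 => //; exact/centersP/SE.
Qed.

Local Notation s3 := (Num.sqrt 3 : R).

Definition diag_dirs : seq R[i] := [:: 1 +i* 1; 1 -i* 1; (-1) +i* 1; (-1) -i* 1].
Definition hor_dirs : seq R[i] :=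
  [:: 0 +i* 2; 0 -i* 2; s3 +i* 1; s3 -i* 1; (- s3) +i* 1; (- s3) -i* 1].
Definition ver_dirs : seq R[i] := [seq Im c +i* Re c | c <- hor_dirs].

(* One direction in each sector cut out at [v] by the lines and circles that
   can bound tiles meeting at [v]; on an edge there are up to three of them,
   crossing at angles of [pi / 3]. *)
Definition dirs v : seq R[i] :=
  if Re v ^+ 2 == 4^-1 then if Im v ^+ 2 == 4^-1 then diag_dirs else ver_dirs
  else if Im v ^+ 2 == 4^-1 then hor_dirs else diag_dirs.

Lemma size_dirs v : (size (dirs v) <= 6)%N.
Proof. by rewrite /dirs; case: ifP => _; case: ifP. Qed.

Lemma s3_sqr : s3 ^+ 2 = 3. Proof. by rewrite sqr_sqrtr. Qed.

Lemma s3_gt0 : 0 < s3. Proof. by rewrite sqrtr_gt0. Qed.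

Lemma sqr1_or (a : R) : a ^+ 2 = 1 -> a = 1 \/ a = -1.
Proof. by rewrite -[in X in _ = X](expr1n R 2); exact: sqr_eq_or. Qed.

Lemma diag_dirsP th : Re th ^+ 2 = 1 -> Im th ^+ 2 = 1 -> th \in diag_dirs.
Proof.
case: th => a b /= /sqr1_or ha /sqr1_or hb; rewrite !inE.
by case: ha => ->; case: hb => ->; rewrite eqxx ?orbT.
Qed.

Lemma hor_dirsP th :
  (Re th = 0 /\ Im th ^+ 2 = 4) \/ (Re th ^+ 2 = 3 /\ Im th ^+ 2 = 1) -> th \in hor_dirs.
Proof.
case: th => a b /=; rewrite !inE => -[[-> hb]|[ha hb]].
  have [->|->] : b = 2 \/ b = - 2 by apply: sqr_eq_or; rewrite hb; ring.
    by rewrite eqxx.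
  by rewrite eqxx orbT.
have {}ha : a = s3 \/ a = - s3 by apply: sqr_eq_or; rewrite ha s3_sqr.
by case: ha => ->; case: (sqr1_or hb) => ->; rewrite eqxx ?orbT.
Qed.

Lemma ver_dirsP th :
  (Im th = 0 /\ Re th ^+ 2 = 4) \/ (Im th ^+ 2 = 3 /\ Re th ^+ 2 = 1) -> th \in ver_dirs.
Proof.
move=> h; apply/mapP; exists (Im th +i* Re th); last by case: (th).
exact: hor_dirsP.
Qed.

Lemma ReMk (a b : R) : Re (a +i* b) = a. Proof. by []. Qed.
Lemma ImMk (a b : R) : Im (a +i* b) = b. Proof. by []. Qed.

Lemma diag_dirs_span x : x != 0 -> exists2 th, th \in diag_dirs & 0 < Re (x * th).
Proof.
case: x => a b ab0; have [a0|a0] := leP 0 a; have [b0|b0] := leP 0 b.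
- exists (1 -i* 1); first by rewrite !inE eqxx ?orbT.
  rewrite ReMul !ReMk !ImMk; have : (a != 0) || (b != 0).
    by rewrite -negb_and; apply: contra ab0 => /andP[/eqP-> /eqP->].
  by case/orP => h; [have : 0 < a by rewrite lt_def h|have : 0 < b by rewrite lt_def h]; lra.
- exists (1 +i* 1); first by rewrite !inE eqxx ?orbT.
  by rewrite ReMul !ReMk !ImMk; lra.
- exists ((-1) -i* 1); first by rewrite !inE eqxx ?orbT.
  by rewrite ReMul !ReMk !ImMk; lra.
- exists ((-1) +i* 1); first by rewrite !inE eqxx ?orbT.
  by rewrite ReMul !ReMk !ImMk; lra.
Qed.

Lemma gunit_sqr u : gunit u -> (Re u ^+ 2 = 1 /\ Im u = 0) \/ (Re u = 0 /\ Im u ^+ 2 = 1).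
Proof. by move/gunitP => -[]->; [left|left|right|right]; rewrite !reimE; split; lra. Qed.

(** The circle equation reads [2 (Re c Re p + Im c Im p) = n2 p + n2 c - 1], which is compared for
    axis and diagonal centres. Hence away from 0 and the edges at most one arc bounds a tile
    locally. *)
Lemma one_circle p c c' : insq true p -> p != 0 -> gcenter c -> gcenter c' ->
  n2 (p - c) = 1 -> n2 (p - c') = 1 -> c = c'.
Proof.
move=> /osqP[p1 p2 p3 p4] p0.
have N0 : 0 < n2 p by rewrite n2_gt0.
have N1 : n2 p < 2^-1.
  have h1 : 0 < (2^-1 - Re p) * (2^-1 + Re p) by apply: mulr_gt0; lra.
  have h2 : 0 < (2^-1 - Im p) * (2^-1 + Im p) by apply: mulr_gt0; lra.
  by rewrite /n2; lra.
have cl d : gcenter d -> n2 (p - d) = 1 ->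
    [\/ [/\ Re d ^+ 2 = 1, Im d = 0 & 2 * (Re d * Re p) = n2 p],
        [/\ Re d = 0, Im d ^+ 2 = 1 & 2 * (Im d * Im p) = n2 p] |
        [/\ Re d ^+ 2 = 1, Im d ^+ 2 = 1, 0 < Re d * Re p & 0 < Im d * Im p] /\
        2 * (Re d * Re p + Im d * Im p) = n2 p + 1].
  move=> [gd hd] h; have e : 2 * (Re d * Re p + Im d * Im p) = n2 p + n2 d - 1.
    by rewrite -[X in _ - X]h /n2 !reimE; ring.
  have [[a|a|a] [b|b|b]] := center_coord gd hd; rewrite /n2 a b in hd e N0 *.
  all: try (by constructor 1; split; lra).
  all: try (by constructor 2; split; lra).
  all: try (by constructor 3; split; [split|]; lra).
move=> gc gc' h h'; have := cl _ gc h; have := cl _ gc' h'.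
have same (a b r : R) : a ^+ 2 = 1 -> b ^+ 2 = 1 -> 0 < a * r -> 0 < b * r -> a = b.
  by move=> /sqr1_or[]-> /sqr1_or[]->; lra.
have sq (a b : R) : a ^+ 2 = 1 -> (a * b) ^+ 2 = b ^+ 2 by move=> ha; rewrite exprMn ha mul1r.
move=> [[a1 b1 e1]|[a1 b1 e1]|[[a1 b1 l1 l1'] e1]] [[a2 b2 e2]|[a2 b2 e2]|[[a2 b2 l2 l2'] e2]].
- by apply: complexP; [apply: (same _ _ (Re p)) => //; lra|rewrite b1 b2].
(* Adding the squared equations gives [2 N^2 = 4 N] for [N = n2 p], impossible when
   [0 < N < 1/2]. *)
- exfalso; have h1 := sq _ (Re p) a1; have h2 := sq _ (Im p) b2.
  have : (2 * (Re c' * Re p)) ^+ 2 + (2 * (Im c * Im p)) ^+ 2 = 4 * n2 p.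
    by rewrite ![(2 * _) ^+ 2]exprMn h1 h2 /n2; ring.
  by rewrite e1 e2; nra.
- exfalso; have : `|Re c * Re p| = `|Re c' * Re p|.
    apply/eqP; rewrite -(@eqrXn2 _ 2)// !real_normK ?num_real// !sq//.
  rewrite !gtr0_norm//; last by lra.
  have : Im c * Im p < 2^-1 by case: (sqr1_or b2) => ->; lra.
  lra.
- exfalso; have h1 := sq _ (Im p) b1; have h2 := sq _ (Re p) a2.
  have : (2 * (Im c' * Im p)) ^+ 2 + (2 * (Re c * Re p)) ^+ 2 = 4 * n2 p.
    by rewrite ![(2 * _) ^+ 2]exprMn h1 h2 /n2; ring.
  by rewrite e1 e2; nra.
- by apply: complexP; [rewrite a1 a2|apply: (same _ _ (Im p)) => //; lra].
- exfalso; have : `|Im c * Im p| = `|Im c' * Im p|.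
    apply/eqP; rewrite -(@eqrXn2 _ 2)// !real_normK ?num_real// !sq//.
  rewrite !gtr0_norm//; last by lra.
  have : Re c * Re p < 2^-1 by case: (sqr1_or a2) => ->; lra.
  lra.
- exfalso; have : `|Re c * Re p| = `|Re c' * Re p|.
    apply/eqP; rewrite -(@eqrXn2 _ 2)// !real_normK ?num_real// !sq//.
  rewrite !gtr0_norm//; last by lra.
  have : Im c' * Im p < 2^-1 by case: (sqr1_or b1) => ->; lra.
  lra.
- exfalso; have : `|Im c * Im p| = `|Im c' * Im p|.
    apply/eqP; rewrite -(@eqrXn2 _ 2)// !real_normK ?num_real// !sq//.
  rewrite !gtr0_norm//; last by lra.
  have : Re c' * Re p < 2^-1 by case: (sqr1_or a1) => ->; lra.
  lra.
- by apply: complexP; [apply: (same _ _ (Re p))|apply: (same _ _ (Im p))].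
Qed.

End Directions.

(** * Pulling directions back to an edge point *)

Section Choice.
Context (R : realType).
Implicit Types z w u c d t x y v p q th tau om : R[i].
Implicit Types m : moeb R.
Implicit Types S : set R[i].
Local Notation s3 := (Num.sqrt 3 : R).

(* The derivative of [mob m] at [v]. *)
Definition dmob m v := mdet m / den m v ^+ 2.

Lemma n2_unit_conj x : n2 x = 1 -> x^-1 = x^*%C.
Proof.
move=> h; have x0 : x != 0 by rewrite -n2_gt0 h.
apply: (mulfI x0); rewrite divff//; apply: complexP; rewrite !reimE; move: h; rewrite /n2; lra.
Qed.

Lemma n2_dmob m v : gmoeb m -> n2 (den m v) = 1 -> n2 (dmob m v) = 1.
Proof. by move=> [_ _ _ _ h] h'; rewrite /dmob n2M n2V expr2 n2M h' h; lra. Qed.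

Lemma ReMulJ x y : Re (x^*%C * y) = Re x * Re y + Im x * Im y.
Proof. by rewrite ReMul ReConj ImConj; ring. Qed.

Lemma ImMulJ x y : Im (x^*%C * y) = Re x * Im y - Im x * Re y.
Proof. by rewrite ImMul ReConj ImConj; ring. Qed.

Lemma mob_affine m v : gmoeb m -> mc m = 0 -> n2 (den m v) = 1 ->
  gunit (dmob m v) /\ exists2 g, gauss_int g & mob m v = dmob m v * v + g.
Proof.
move=> [ga gb gc gd det] c0; rewrite /den c0 mul0r add0r => d1.
have gu : gunit (md m) by [].
have e : dmob m v = ma m * (md m)^*%C.
  by rewrite /dmob /mdet /den c0 mulr0 subr0 mul0r add0r -gunitV//; field; exact: gunit_neq0.
have a1 : n2 (ma m) = 1 by move: det; rewrite /mdet c0 mulr0 subr0 n2M d1 mulr1.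
split; first by rewrite e; apply: gunitM; [split|exact: gunitJ].
exists (mb m * (md m)^*%C); first by apply: gaussM => //; exact: gaussJ.
by rewrite e /mob /den c0 mul0r add0r gunitV//; ring.
Qed.

(** On the isometric circle [1 / (v - q)] is a conjugate, so the value is a reflection of [v]. The
    argument of the derivative involves twice that of [v - q]; for half-integer coordinates this
    yields angles that are multiples of [pi / 3]. *)
Lemma mob_inversion m v : gmoeb m -> n2 (mc m) = 1 -> n2 (den m v) = 1 ->
  exists q e k, [/\ gauss_int q, gauss_int e, gunit k, n2 (v - q) = 1 &
    mob m v = e + k * (v - q)^*%C /\ dmob m v = - k * (v - q)^*%C ^+ 2].
Proof.
move=> gm c1 d1; have [ga gb gc gd det] := gm.
have vv : Normc.normc (v - v) <= 1 / 10 by rewrite subrr Normc.normc0; lra.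
have [p1 _] := pole_bound gm c1 d1 vv.
have gk : gunit (- mdet m * (mc m)^*%C ^+ 2).
  by rewrite expr2; do !apply: gunitM; try apply: gunitJ; [exact/gunitN/gauss_det|split|split].
exists (- md m * (mc m)^*%C), (ma m * (mc m)^*%C), (- mdet m * (mc m)^*%C ^+ 2).
split=> //; [by apply/gaussM/gaussJ => //; exact: gaussN|by apply/gaussM/gaussJ|].
have q0 : v - - md m * (mc m)^*%C != 0 by rewrite -n2_gt0 p1.
split; first by rewrite mob_pole// n2_unit_conj.
rewrite /dmob; have -> : den m v = mc m * (v - - md m * (mc m)^*%C).
  rewrite /den -[in LHS](mulr1 (md m)) -(gunitMJ (conj gc c1)); ring.
move: (v - _) q0 p1 => s s0 p1; rewrite -(n2_unit_conj p1) -(n2_unit_conj c1); field.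
by rewrite s0 -n2_gt0 c1 ltr01.
Qed.

Lemma half_int (a e n : R) : e ^+ 2 = 4^-1 -> n \is a Num.int -> a ^+ 2 <= 4^-1 ->
  a = e + n -> a ^+ 2 = 4^-1.
Proof.
move=> he ni ha h.
have /andP[a1 a2] : - 2^-1 <= a <= 2^-1 by apply: sqr_half_bounds; lra.
have {}he : e = 2^-1 \/ e = - 2^-1 by apply: sqr_eq_or; lra.
suff [->|->] : a = 2^-1 \/ a = - 2^-1 by lra.
have := int_cases ni; case: he => e'; rewrite e' in h.
  by case=> [||n'|n'|n']; [lra|lra|right; lra|left; lra|lra].
by case=> [||n'|n'|n']; [lra|lra|lra|right; lra|left; lra].
Qed.

(** [A + i B] is a sixth root of unity other than 1 and -1. Writing [B] as plus or minus
    [A * Re tau * Im tau] covers all sign choices at once. *)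
Lemma hor_rot tau (A B : R) : A ^+ 2 = 4^-1 -> B ^+ 2 = 3 / 4 ->
  Re tau ^+ 2 = 3 -> Im tau ^+ 2 = 1 -> (A +i* B) * tau \in hor_dirs R.
Proof.
move=> hA hB h1 h2.
have : B ^+ 2 = (A * Re tau * Im tau) ^+ 2 by rewrite !exprMn hA hB h1 h2; lra.
move=> /sqr_eq_or hb; apply: hor_dirsP; rewrite ReMul ImMul !ReMk !ImMk.
case: hb => ->; [left|right].
- split.
    have -> : A * Re tau - A * Re tau * Im tau * Im tau = A * Re tau * (1 - Im tau ^+ 2) by ring.
    by rewrite h2 subrr mulr0.
  have -> : A * Im tau + A * Re tau * Im tau * Re tau = A * Im tau * (1 + Re tau ^+ 2) by ring.
  by rewrite h1 !exprMn hA h2; lra.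
- split.
    have -> : A * Re tau - - (A * Re tau * Im tau) * Im tau = A * Re tau * (1 + Im tau ^+ 2) by ring.
    by rewrite h2 !exprMn hA h1; lra.
  have -> : A * Im tau + - (A * Re tau * Im tau) * Re tau = A * Im tau * (1 - Re tau ^+ 2) by ring.
  by rewrite h1 !exprMn hA h2; lra.
Qed.

Lemma ver_rot tau (A B : R) : A ^+ 2 = 3 / 4 -> B ^+ 2 = 4^-1 ->
  Re tau ^+ 2 = 3 -> Im tau ^+ 2 = 1 -> (A +i* B) * tau \in ver_dirs R.
Proof.
move=> hA hB h1 h2.
have : A ^+ 2 = (B * Re tau * Im tau) ^+ 2 by rewrite !exprMn hA hB h1 h2; lra.
move=> /sqr_eq_or hb; apply: ver_dirsP; rewrite ReMul ImMul !ReMk !ImMk.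
case: hb => ->; [right|left].
- split.
    have -> : B * Re tau * Im tau * Im tau + B * Re tau = B * Re tau * (1 + Im tau ^+ 2) by ring.
    by rewrite h2 !exprMn hB h1; lra.
  have -> : B * Re tau * Im tau * Re tau - B * Im tau = B * Im tau * (Re tau ^+ 2 - 1) by ring.
  by rewrite h1 !exprMn hB h2; lra.
- split.
    have -> : - (B * Re tau * Im tau) * Im tau + B * Re tau = B * Re tau * (1 - Im tau ^+ 2) by ring.
    by rewrite h2 subrr mulr0.
  have -> : - (B * Re tau * Im tau) * Re tau - B * Im tau = - (B * Im tau * (1 + Re tau ^+ 2)) by ring.
  by rewrite h1 sqrrN !exprMn hB h2; lra.
Qed.

Lemma conj_solve om tau : n2 om = 1 -> om * (om^*%C * tau) = tau.
Proof.
by move=> h; rewrite mulrA -(n2_unit_conj h) divff ?mul1r// -n2_gt0 h.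
Qed.

Definition hor_dir p : R[i] := (- ((if 0 < Re p then 1 else -1) * s3)) +i* (- (2 * Im p)).

Lemma hor_dir_sqr p : Im p ^+ 2 = 4^-1 -> Re (hor_dir p) ^+ 2 = 3 /\ Im (hor_dir p) ^+ 2 = 1.
Proof.
move=> h; rewrite /hor_dir !ReMk !ImMk !sqrrN !exprMn s3_sqr h.
by case: ifP => _; rewrite ?sqrrN expr1n; split; lra.
Qed.

(** A circle through [p] has its centre at height difference 1/2, as 3/2 exceeds the radius, hence
    at horizontal distance [s3 / 2]. Since [|Re p| < 1/2], that centre lies on the outer side of
    [p], and [hor_dir] leans towards the imaginary axis. *)
Lemma hor_dir_inside S p : S `<=` @gcenter R -> Im p ^+ 2 = 4^-1 -> Re p ^+ 2 < 4^-1 ->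
  points_inside S p (hor_dir p).
Proof.
move=> SE hi hr; have s30 := s3_gt0 R; have s32 := s3_sqr R.
have /andP[r1 r2] : - 2^-1 <= Re p <= 2^-1 by apply: sqr_half_bounds; lra.
split.
  have nr (a : R) : a = 2^-1 \/ a = - 2^-1 -> a ^+ 2 = 4^-1 by case=> ->; lra.
  have eI : Im (hor_dir p) = - (2 * Im p) by [].
  move=> u /gunitP[]->; rewrite !ReMul ?ReOpp ?ImOpp ?ReOne ?ImOne ?ReI ?ImI ?eI => h.
  - by have := nr (Re p) ltac:(left; lra); lra.
  - by have := nr (Re p) ltac:(right; lra); lra.
  - lra.
  - lra.
move=> c /SE[gc hc] h; have {hc} [hcr hci] := center_coord gc hc.
have h' : (Re p - Re c) ^+ 2 + (Im p - Im c) ^+ 2 = 1 by rewrite -h /n2 !reimE.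
have ip : Im p = 2^-1 \/ Im p = - 2^-1 by apply: sqr_eq_or; lra.
have di : (Im p - Im c) ^+ 2 = 4^-1 \/ (Im p - Im c) ^+ 2 = 9 / 4.
  by case: hci => ->; case: ip => ->; [right|left|left|left|left|right]; lra.
case: di => di; last by have := sqr_ge0 (Re p - Re c); lra.
have e3 : Re p - Re c = s3 / 2 \/ Re p - Re c = - (s3 / 2).
  by apply: sqr_eq_or; rewrite exprMn s32; lra.
have s31 : 1 < s3 by rewrite -(@ltr_pXn2r _ 2)// ?nnegrE ?ltW// expr1n s32; lra.
have s34 : s3 < 2 by rewrite -(@ltr_pXn2r _ 2)// ?nnegrE ?ltW// s32; lra.
have key : (if 0 < Re p then 1 else -1) * s3 = - (2 * (Re p - Re c)).
  case: ifP => rp; [have : 0 < Re p by []|have : Re p <= 0 by rewrite leNgt rp].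
    by move=> {}rp; case: hcr => hcr; rewrite hcr in e3 *; case: e3; lra.
  by move=> {}rp; case: hcr => hcr; rewrite hcr in e3 *; case: e3; lra.
have eR : Re (hor_dir p) = 2 * (Re p - Re c) by rewrite /hor_dir ReMk key opprK.
have eI : Im (hor_dir p) = - (2 * Im p) by [].
have -> : Re ((p - c)^*%C * hor_dir p) =
    2 * (Re p - Re c) ^+ 2 - 2 * ((Im p - Im c) * Im p).
  by rewrite ReMul eR eI ReConj ImConj ReAdd ImAdd ReOpp ImOpp; ring.
have e2 : (Re p - Re c) ^+ 2 = 3 / 4 by lra.
have e4 : (Im p - Im c) * Im p <= 4^-1.
  by case: hci di => ->; case: ip => ->; lra.
lra.
Qed.

Lemma csq_sqr v : insq false v -> Re v ^+ 2 <= 4^-1 /\ Im v ^+ 2 <= 4^-1.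
Proof. by move=> /csqP[? ? ? ?]; split; nra. Qed.

(** The direction is chosen at the image, where the walls of the second tile are explicit, and
    pulled back by the conjugate of the unimodular derivative. The work is to show that it lands in
    the list at [v], which does not depend on [m]. *)
Lemma dirs_hor S v m : S `<=` @gcenter R -> insq false v -> chart v m ->
  Im (mob m v) ^+ 2 = 4^-1 -> Re (mob m v) ^+ 2 < 4^-1 ->
  exists2 th, th \in dirs v & points_inside S (mob m v) (dmob m v * th).
Proof.
move=> SE sv ch hi hr; have [gm d1 sy c2] := ch.
have n1 := n2_dmob gm d1; have [v1 v2] := csq_sqr sv.
exists ((dmob m v)^*%C * hor_dir (mob m v)); last by rewrite conj_solve//; exact: hor_dir_inside.
have [t1 t2] := hor_dir_sqr hi.
have v0 : v != 0.
  by rewrite -n2_gt0 -(sqsym_n2 sy) /n2 hi; have := sqr_ge0 (Re (mob m v)); lra.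
have c1 := chart_neq0 v0 ch.
have HH : Im v ^+ 2 = 4^-1 -> dirs v = hor_dirs R.
  move=> h; rewrite /dirs h eqxx; case: ifP => // /eqP h2; exfalso.
  by case: sy; rewrite h h2; lra.
have VV : Re v ^+ 2 = 4^-1 -> dirs v = ver_dirs R.
  move=> h; rewrite /dirs h eqxx; case: ifP => // /eqP h2; exfalso.
  by case: sy; rewrite h h2; lra.
have [gc _ _ _] : [/\ gauss_int (mc m), True, True & True] by case: gm.
have [c0|{}c1] := n2_cases gc c1.
  have [gu [g [gr gi] e]] := mob_affine gm c0 d1.
  have ei : Im (mob m v) = Re (dmob m v) * Im v + Im (dmob m v) * Re v + Im g.
    by rewrite e ImAdd ImMul.
  case: (gunit_sqr gu) => -[u1 u2].
    rewrite HH; first by apply: hor_dirsP; right; rewrite ReMulJ ImMulJ u2 !mul0r subr0 addr0 !exprMn u1 t1 t2; lra.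
    have -> : Im v ^+ 2 = (Re (dmob m v) * Im v) ^+ 2 by rewrite exprMn u1 mul1r.
    apply: (half_int (e := Im (mob m v)) (n := - Im g)) => //; rewrite ?rpredN//.
      by rewrite exprMn u1 mul1r.
    by rewrite ei u2 mul0r; ring.
  rewrite VV; first by apply: ver_dirsP; right; rewrite ReMulJ ImMulJ u1 !mul0r sub0r add0r sqrrN !exprMn u2 t1 t2; lra.
  have -> : Re v ^+ 2 = (Im (dmob m v) * Re v) ^+ 2 by rewrite exprMn u2 mul1r.
  apply: (half_int (e := Im (mob m v)) (n := - Im g)) => //; rewrite ?rpredN//.
    by rewrite exprMn u2 mul1r.
  by rewrite ei u1 mul0r; ring.
have [q [e [k [[qr qi] [er ei] gk s1 [ep ed]]]]] := mob_inversion gm c1 d1.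
set s := v - q in s1 ep ed.
have vs : v = s + q by rewrite /s subrK.
clearbody s.
have is1 : Re s ^+ 2 + Im s ^+ 2 = 1 by [].
have eim : Im (mob m v) = Im e - Re k * Im s + Im k * Re s.
  by rewrite ep !reimE; ring.
have odd (a n : R) : n \is a Num.int -> a ^+ 2 <= 1 -> Im (mob m v) = n + a -> a ^+ 2 = 4^-1.
  move=> ni a1 h; have ip : Im (mob m v) = 2^-1 \/ Im (mob m v) = - 2^-1 by apply: sqr_eq_or; lra.
  have [b1 b2] : -1 <= a /\ a <= 1 by split; nra.
  suff [->|->] : a = 2^-1 \/ a = - 2^-1 by lra.
  have := int_cases ni; rewrite h in ip; case: ip => ip.
    by case=> [||n'|n'|n']; lra.
  by case=> [||n'|n'|n']; lra.
(* A real [k] makes [Im s], hence [Im v], half-integral; an imaginary [k] does the same for the real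
   parts and exchanges the two kinds of edge. *)
case: (gunit_sqr gk) => -[k1 k2].
  have h1 : Im s ^+ 2 = 4^-1.
    have -> : Im s ^+ 2 = (- (Re k * Im s)) ^+ 2 by rewrite sqrrN exprMn k1 mul1r.
    apply: (odd _ (Im e)) => //; last by rewrite eim k2 mul0r addr0.
    by rewrite sqrrN exprMn k1 mul1r; have := sqr_ge0 (Re s); lra.
  have iv : Im v ^+ 2 = 4^-1.
    by apply: (half_int (e := Im s) (n := Im q)) => //; rewrite {1}vs ImAdd.
  rewrite HH//.
  have -> : (dmob m v)^*%C = (- (Re k * 2^-1)) +i* (- (Re k * (2 * Re s * Im s))).
    have h2 : Re s ^+ 2 = 3 / 4 by lra.
    have dr : Re (dmob m v)^*%C = - (Re k * 2^-1).
      by rewrite ed expr2 !reimE k2 (_ : 2^-1 = Re s ^+ 2 - Im s ^+ 2); [ring|lra].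
    have di : Im (dmob m v)^*%C = - (Re k * (2 * Re s * Im s)).
      by rewrite ed expr2 !reimE k2; ring.
    by apply: complexP; [exact: dr|exact: di].
  apply: hor_rot => //; rewrite sqrrN !exprMn k1.
    lra.
  by rewrite h1 (_ : Re s ^+ 2 = 3 / 4); lra.
have h1 : Re s ^+ 2 = 4^-1.
  have -> : Re s ^+ 2 = (Im k * Re s) ^+ 2 by rewrite exprMn k2 mul1r.
  apply: (odd _ (Im e)) => //; last by rewrite eim k1 mul0r subr0.
  by rewrite exprMn k2 mul1r; have := sqr_ge0 (Im s); lra.
have rv : Re v ^+ 2 = 4^-1.
  by apply: (half_int (e := Re s) (n := Re q)) => //; rewrite {1}vs ReAdd.
rewrite VV//.
have -> : (dmob m v)^*%C = (- (Im k * (2 * Re s * Im s))) +i* (- (Im k * 2^-1)).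
  have h2 : Im s ^+ 2 = 3 / 4 by lra.
  have dr : Re (dmob m v)^*%C = - (Im k * (2 * Re s * Im s)).
    by rewrite ed expr2 !reimE k1; ring.
  have di : Im (dmob m v)^*%C = - (Im k * 2^-1).
    by rewrite ed expr2 !reimE k1 (_ : 2^-1 = Im s ^+ 2 - Re s ^+ 2); [ring|lra].
  by apply: complexP; [exact: dr|exact: di].
apply: ver_rot => //; rewrite sqrrN !exprMn k2.
  by rewrite h1 (_ : Im s ^+ 2 = 3 / 4); lra.
lra.
Qed.

End Choice.

(** * Vertical edges, corners, the centre and the other inner points *)

Section Choice2.
Context (R : realType).
Implicit Types z w u c d t x y v p q th tau om : R[i].
Implicit Types m : moeb R.
Implicit Types S : set R[i].

Lemma sqsym_gunit u x : gunit u -> sqsym x (u * x).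
Proof.
move=> gu; rewrite /sqsym ReMul ImMul.
by case: (gunit_sqr gu) => -[u1 u2]; [left|right]; rewrite ?u1 ?u2 !mul0r;
  rewrite ?subr0 ?addr0 ?sub0r ?add0r ?sqrrN !exprMn ?u1 ?u2 !mul1r.
Qed.

Lemma sqsym_trans x y z : sqsym x y -> sqsym y z -> sqsym x z.
Proof. by move=> [[a b]|[a b]] [[c d]|[c d]]; rewrite /sqsym c d a b; auto. Qed.

Lemma chart_rot u v m : gunit u -> chart v m -> chart v (rotm u m).
Proof.
move=> gu [gm d1 sy c2]; split=> //; first exact: gmoeb_rot.
by rewrite mob_rot; apply: sqsym_trans sy (sqsym_gunit _ gu).
Qed.

Definition rot_centers u S : set R[i] := [set c | S (u^*%C * c)].

Lemma points_inside_rot u S p tau : gunit u ->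
  points_inside (rot_centers u S) (u * p) (u * tau) -> points_inside S p tau.
Proof.
move=> gu [hl hc]; have uu := gunitMJ gu.
have u1 x : u^*%C * (u * x) = x by rewrite mulrA [_^*%C * u]mulrC uu mul1r.
split.
- move=> w gw e; have := hl (w * u^*%C); rewrite -!mulrA !u1; apply=> //.
  exact: gunitM gw (gunitJ gu).
- move=> c Sc n1; have := hc (u * c).
  rewrite /rot_centers /= u1 -mulrBr n2M; case: (gu) => _ ->.
  rewrite mul1r => /(_ Sc n1); rewrite (_ : (u * (p - c))^*%C * (u * tau) = (p - c)^*%C * tau)//.
  by rewrite -[RHS]mul1r -uu; apply: complexP; rewrite !reimE; ring.
Qed.

Lemma rot_centers_sub u S : gunit u -> S `<=` @gcenter R -> rot_centers u S `<=` @gcenter R.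
Proof.
move=> gu SE c /SE[g h]; have uu := gunitMJ gu.
have e : c = u * (u^*%C * c) by rewrite mulrA uu mul1r.
split; first by rewrite e; apply: gaussM => //; case: gu.
by move: h; rewrite n2M n2J; case: gu => _ ->; rewrite mul1r.
Qed.

Lemma dirs_ver S v m : S `<=` @gcenter R -> insq false v -> chart v m ->
  Re (mob m v) ^+ 2 = 4^-1 -> Im (mob m v) ^+ 2 < 4^-1 ->
  exists2 th, th \in dirs v & points_inside S (mob m v) (dmob m v * th).
Proof.
move=> SE sv ch hr hi.
have eI : Im ('i * mob m v) = Re (mob m v) by rewrite ImMul ReI ImI; ring.
have eR : Re ('i * mob m v) = - Im (mob m v) by rewrite ReMul ReI ImI; ring.
have [th hth pin] : exists2 th, th \in dirs v &
    points_inside (rot_centers 'i S) (mob (rotm 'i m) v) (dmob (rotm 'i m) v * th).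
  apply: dirs_hor => //; rewrite ?mob_rot ?eI ?eR ?sqrrN//.
    exact: rot_centers_sub (gunitI R) SE.
  exact: chart_rot (gunitI R) ch.
exists th => //; apply: (points_inside_rot (gunitI R)).
move: pin; rewrite mob_rot /dmob /mdet /den /= -!mulrA.
by rewrite (_ : 'i * (ma m * md m) - 'i * (mb m * mc m) = 'i * (ma m * md m - mb m * mc m)) -?mulrA//; ring.
Qed.

(** No unit circle about a Gaussian integer passes through a corner. So [m] cannot be an inversion,
    no disc is active at the image, and the diagonal towards 0 points inside. *)
Lemma dirs_corner S v m : S `<=` @gcenter R -> insq false v -> chart v m ->
  Im (mob m v) ^+ 2 = 4^-1 -> Re (mob m v) ^+ 2 = 4^-1 ->
  exists2 th, th \in dirs v & points_inside S (mob m v) (dmob m v * th).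
Proof.
move=> SE sv ch hi hr; have [gm d1 sy c2] := ch.
have [rv iv] : Re v ^+ 2 = 4^-1 /\ Im v ^+ 2 = 4^-1 by case: sy => -[]; rewrite hr hi.
have nv : n2 v = 2^-1 by rewrite /n2 rv iv; lra.
have v0 : v != 0 by rewrite -n2_gt0 nv; lra.
have c1 := chart_neq0 v0 ch; have [ga gb gc gd _] := gm.
have vv : Normc.normc (v - v) <= 1 / 10 by rewrite subrr Normc.normc0; lra.
have [c0|{}c1] := n2_cases gc c1; last first.
  have [p1 _] := pole_bound gm c1 d1 vv.
  by case: (corner_circle sv nv _ p1); apply: gaussM; [exact: gaussN|exact: gaussJ].
have [gu _] := mob_affine gm c0 d1; have n1 := n2_dmob gm d1.
have sp := sqsym_csq sy sv; have np : n2 (mob m v) = 2^-1 by rewrite (sqsym_n2 sy).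
move: (mob m v) hi hr sp np {sy} => p hi hr sp np.
exists ((dmob m v)^*%C * - (p + p)).
  rewrite /dirs rv iv eqxx.
  have [[e1 e2]|[e1 e2]] := sqsym_gunit (- (p + p)) (gunitJ gu);
    by apply: diag_dirsP; rewrite ?e1 ?e2 ?ReOpp ?ImOpp ?ReAdd ?ImAdd; lra.
rewrite conj_solve//; split.
  by move=> u gu' e; rewrite mulrN ReOpp mulrDr ReAdd e; lra.
by move=> c /SE[gc' _] h; case: (corner_circle sp np gc' h).
Qed.

Lemma dirs_zero S v m : S `<=` @gcenter R -> chart v m ->
  (forall u, gunit u -> S u -> S (- u) -> False) -> mob m v = 0 ->
  exists2 th, th \in dirs v & points_inside S (mob m v) (dmob m v * th).
Proof.
move=> SE ch opp p0; have [gm d1 sy c2] := ch.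
have v0 : v = 0 by apply/eqP; rewrite -n2_eq0 -(sqsym_n2 sy) p0 n2_0.
have dd : den m v = md m by rewrite /den v0 mulr0 add0r.
have gu : gunit (dmob m v).
  have gd : gunit (md m) by rewrite dd in d1; case: gm.
  have gd2 : gunit (md m ^+ 2) by rewrite expr2; exact: gunitM.
  by rewrite /dmob dd gunitV//; apply: gunitM (gauss_det gm) (gunitJ gd2).
rewrite p0.
(* The quadrant turns away from the discs about 1 and ['i] when they occur; otherwise it turns away
   from those about -1 and [- 'i]. By [opp] this avoids all of them. *)
pose s1 : R := if pselect (S 1) then -1 else 1.
pose s2 : R := if pselect (S 'i) then -1 else 1.
have hs1 : s1 ^+ 2 = 1 by rewrite /s1; case: pselect => h /=; rewrite ?sqrrN expr1n.
have hs2 : s2 ^+ 2 = 1 by rewrite /s2; case: pselect => h /=; rewrite ?sqrrN expr1n.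
exists ((dmob m v)^*%C * (s1 +i* s2)).
  have -> : dirs v = diag_dirs R.
    have f : (0 == 4^-1 :> R) = false by apply/eqP; lra.
    by rewrite v0 /dirs ReZero ImZero expr0n /= f.
  have [[e1 e2]|[e1 e2]] := sqsym_gunit (s1 +i* s2) (gunitJ gu); by apply: diag_dirsP; rewrite ?e1 ?e2 ?ReMk ?ImMk.
rewrite conj_solve; last by case: gu.
split; first by move=> u _; rewrite mulr0 ReZero => h; exfalso; move: h; lra.
move=> c Sc; rewrite sub0r n2N => nc; have [gc _] := SE _ Sc.
have eR : Re ((- c)^*%C * (s1 +i* s2)) = - (Re c * s1 + Im c * s2).
  by rewrite ReMulJ ReOpp ImOpp ReMk ImMk; ring.
rewrite eR; have := gunitP (conj gc nc) => -[ec|ec|ec|ec]; rewrite ec ?ReOpp ?ImOpp ?reimE in Sc *.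
- by rewrite /s1; case: pselect => // h /=; lra.
- rewrite /s1; case: pselect => [S1|h] /=; last lra.
  by case: (opp _ (gunit1 R) S1 Sc).
- by rewrite /s2; case: pselect => // h /=; lra.
- rewrite /s2; case: pselect => [S1|h] /=; last lra.
  by case: (opp _ (gunitI R) S1 Sc).
Qed.

Lemma dirs_inner S v m : S `<=` @gcenter R -> insq false v -> chart v m ->
  mob m v != 0 -> Im (mob m v) ^+ 2 < 4^-1 -> Re (mob m v) ^+ 2 < 4^-1 ->
  exists2 th, th \in dirs v & points_inside S (mob m v) (dmob m v * th).
Proof.
move=> SE sv ch p0 hi hr; have [gm d1 sy c2] := ch.
have n1 := n2_dmob gm d1.
have -> : dirs v = diag_dirs R.
  rewrite /dirs; case: ifPn => [/eqP rv|_]; case: ifPn => // /eqP iv; exfalso;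
  by case: sy => -[e1 e2]; lra.
have sq : insq true (mob m v).
  have lt (a : R) : a ^+ 2 < 4^-1 -> - 2^-1 < a /\ a < 2^-1 by move=> h; split; nra.
  by have [? ?] := lt _ hr; have [? ?] := lt _ hi; apply/osqP.
have line u : gunit u -> Re (u * mob m v) = 2^-1 -> False.
  by move=> gu e; have := sq _ gu; rewrite /= e ltxx.
have [[c [Sc nc]]|none] := pselect (exists c, S c /\ n2 (mob m v - c) = 1); last first.
  exists (1 +i* 1); first by rewrite inE eqxx.
  by split=> [u gu /(line _ gu)//|c Sc nc]; case: none; exists c.
have x0 : (mob m v - c)^*%C * dmob m v != 0.
  by rewrite -n2_gt0 n2M n2J nc n1 mulr1.
have [th hth pos] := diag_dirs_span x0.
exists th => //; split=> [u gu /(line _ gu)//|c' Sc' nc'].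
by rewrite -(one_circle sq p0 (SE _ Sc) (SE _ Sc') nc nc') mulrA.
Qed.

Lemma chart_dir S v m : S `<=` @gcenter R -> insq false v -> chart v m ->
  (forall u, gunit u -> S u -> S (- u) -> False) ->
  exists2 th, th \in dirs v & points_inside S (mob m v) (dmob m v * th).
Proof.
move=> SE sv ch opp; have [gm d1 sy c2] := ch.
have [hr hi] := csq_sqr (sqsym_csq sy sv).
move: hr hi; rewrite !le_eqVlt => /orP[/eqP hr|hr] /orP[/eqP hi|hi].
- exact: dirs_corner.
- exact: dirs_ver.
- exact: dirs_hor.
- have [p0|p0] := eqVneq (mob m v) 0; first exact: dirs_zero.
  exact: dirs_inner.
Qed.

(** First-order expansion with explicit error: [den m] stays at least 4/5 along the ray and moves by
    [r] times a constant. *)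
Lemma mob_ray v m th : chart v m -> forall e : R, 0 < e ->
  exists2 r0, 0 < r0 & forall r : R, 0 < r -> r < r0 -> exists2 ka,
    mob m (v + r%:C * th) = mob m v + r%:C * ka & Normc.normc (ka - dmob m v * th) < e.
Proof.
move=> [gm d1 sy c2] e e0.
have mc2 : n2 (mc m) <= 2 by case: c2 => [|[]]; lra.
have T0 := normc_ge0 th; have M0 := normc_ge0 (mc m * th).
exists (Num.min (1 / 10 / (Normc.normc th + 1)) (e / (Normc.normc th * Normc.normc (mc m * th) + 1) / 2)).
  by rewrite lt_min !divr_gt0//; have := mulr_ge0 T0 M0; lra.
move=> r r1; rewrite lt_min => /andP[r2 r3].
have dv0 : den m v != 0 by rewrite -n2_gt0 d1.
have nr : Normc.normc (v + r%:C * th - v) <= 1 / 10.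
  rewrite addrAC subrr add0r normc_real ?ltW//.
  by move: r2; rewrite ltr_pdivlMr; [nra|lra].
have dn := den_close mc2 d1 nr; have dt0 : den m (v + r%:C * th) != 0 by rewrite -normc_gt0; lra.
exists (mdet m * th / (den m (v + r%:C * th) * den m v)).
  have := mob_sub dt0 dv0; rewrite [v + _ - v]addrAC subrr add0r => h.
  rewrite -[LHS](subrK (mob m v)) h [_ + mob m v]addrC; congr (_ + _).
  by rewrite mulrCA -!mulrA.
rewrite /dmob (_ : _ - _ = - (dmob m v * th * (r%:C * (mc m * th)) / den m (v + r%:C * th))); last first.
  rewrite /dmob; have -> : r%:C * (mc m * th) = den m (v + r%:C * th) - den m v.
    by rewrite /den; ring.
  by field; rewrite dt0 dv0.
have nd : Normc.normc (dmob m v) = 1.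
  by apply/eqP; rewrite -(@eqrXn2 _ 2)// ?normc_ge0// -n2_normc n2_dmob// expr1n.
rewrite normcN Normc.normcM Normc.normcV -mulrA Normc.normcM nd mul1r Normc.normcM.
rewrite normc_real ?ltW//; move: r3; rewrite ltr_pdivlMr ?ltr_pdivlMr//; last first.
  by have := mulr_ge0 T0 M0; lra.
rewrite ltr_pdivrMr; last by lra.
have := mulr_ge0 T0 M0; move: (Normc.normc th) (Normc.normc (mc m * th)) (Normc.normc (den _ _)) dn.
by move=> a b c hc ab h; nra.
Qed.

Lemma mob_tile_dir S v m : S `<=` @gcenter R -> insq false v -> chart v m ->
  (forall u, gunit u -> S u -> S (- u) -> False) -> tile false S (mob m v) ->
  exists2 th, th \in dirs v & exists2 r0, 0 < r0 &
    forall r : R, 0 < r -> r < r0 -> tile true S (mob m (v + r%:C * th)).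
Proof.
move=> SE sv ch opp tp; have [th hth pin] := chart_dir SE sv ch opp.
exists th => //; have [e e0 he] := points_inside_tile SE tp pin.
have [r0 r00 hr] := mob_ray th ch e0.
exists (Num.min r0 e); first by rewrite lt_min r00.
move=> r rp; rewrite lt_min => /andP[r1 r2].
by have [ka -> hka] := hr _ rp r1; exact: he.
Qed.

End Choice2.

(** * Generic points and compactness *)

Section Topology.
Context (R : realType).
Implicit Types z w u c d t x y v s : R[i].
Implicit Types a b : seq R[i].
Local Notation T := (@hurwitz_map R).

Lemma ball_normc z y (r : R) : ball z r%:C y <-> Normc.normc (z - y) < r.
Proof.
rewrite -ball_normE /ball_ /= normc_def -(@ltcR R); by case: (z - y).
Qed.

Lemma nbhs_normc z (P : set R[i]) :
  nbhs z P <-> exists2 r : R, 0 < r & forall y, Normc.normc (y - z) < r -> P y.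
Proof.
split=> [/nbhs_ballP[e /= e0 h]|[r r0 h]].
  (* In the order on complex numbers a positive radius is real. *)
  have er : e = (Re e)%:C.
    by move: e0; rewrite ltcE /= => /andP[/eqP i0 _]; apply: complexP; rewrite ?ReReal ?ImReal.
  exists (Re e); first by rewrite -ltcR -er.
  by move=> y hy; apply: h; rewrite er; apply/ball_normc; rewrite normcB.
apply/nbhs_ballP; exists r%:C; first by rewrite /= ltcR.
by move=> y /ball_normc; rewrite normcB; exact: h.
Qed.

Lemma closure_normc (A : set R[i]) z :
  closure A z <-> forall r : R, 0 < r -> exists2 y, A y & Normc.normc (y - z) < r.
Proof.
split=> h.
  move=> r r0; have [|y [Ay hy]] := h [set y | Normc.normc (y - z) < r].
    by apply/nbhs_normc; exists r.
  by exists y.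
move=> B /nbhs_normc[r r0 hr]; have [y Ay hy] := h _ r0.
by exists y; split=> //; exact: hr.
Qed.

Lemma osq_open z : insq true z ->
  exists2 r : R, 0 < r & forall y, Normc.normc (y - z) < r -> insq true y.
Proof.
move=> sz; have [r r0 h] : exists2 e : R, 0 < e & forall u, u \in units R -> forall y,
    Normc.normc (y - z) < e -> Re (u * y) < 2^-1.
  apply: eps_seq => [u e e' h e'0 ee' y hy|u /gunit_units gu]; first by apply: h; exact: lt_le_trans ee'.
  have := sz _ gu => /= su; exists (2^-1 - Re (u * z)); first by lra.
  move=> y; rewrite -(normc_gunitM _ gu) => hy.
  by have := le_lt_trans (Re_le_normc _) hy; rewrite mulrBr ReAdd ReOpp; lra.
by exists r => // y hy u gu; apply: h => //; exact: unitsP.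
Qed.

Lemma inv_continuous w : w != 0 -> forall e : R, 0 < e ->
  exists2 r : R, 0 < r & forall y, Normc.normc (y - w) < r -> y != 0 /\ Normc.normc (y^-1 - w^-1) < e.
Proof.
move=> w0 e e0; have n0 : 0 < Normc.normc w by rewrite normc_gt0.
set n := Normc.normc w in n0.
exists (Num.min (n / 2) (e * n ^+ 2 / 2)).
  by rewrite lt_min !divr_gt0//= ?mulr_gt0 ?exprn_gt0.
move=> y; rewrite lt_min => /andP[y1 y2].
have ny : n / 2 < Normc.normc y.
  by have := normc_tri w 0 y; rewrite !subr0 normcB -/n; lra.
have y0 : y != 0 by rewrite -normc_gt0; lra.
split=> //; rewrite inv_diff// -/n ltr_pdivrMr; last by rewrite mulr_gt0//; lra.
by have := mulr_gt0 e0 n0; nra.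
Qed.

Lemma shrink_hsquare z : hsquare z -> forall e : R, 0 < e ->
  exists2 y, insq true y & Normc.normc (y - z) < e.
Proof.
move=> /hsquareP[z1 z2 z3 z4] e e0.
have [e1|e1] := leP e 1; last first.
  exists 0; first by apply/osqP; rewrite ReZero ImZero; split; lra.
  rewrite sub0r normcN; apply: le_lt_trans (normc_csq _) _; last by lra.
  by apply/csqP; split; lra.
exists ((1 - e / 2)%:C * z).
  by apply/osqP; rewrite !reimE !mul0r subr0 addr0; split; nra.
rewrite (_ : _ - z = - ((e / 2)%:C * z)); last first.
  by apply: complexP; rewrite !reimE; ring.
rewrite normcN normc_real; last lra.
have : Normc.normc z <= 3 / 4 by apply: normc_csq; apply/csqP; split; lra.
by have := normc_ge0 z; nra.
Qed.

(** A nearby interior nonzero point is inverted, its fractional part is approximated by a generic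
    point, and the same digit leads back. *)
Lemma generic_dense n z : hsquare z -> forall e : R, 0 < e ->
  exists2 y, generic n y & Normc.normc (y - z) < e.
Proof.
elim: n z => [|n IH] z hz e e0.
  by have [y sy ny] := shrink_hsquare hz e0; exists y.
have e20 : 0 < e / 3 by lra.
have [z1 sz1 nz1] := shrink_hsquare hz e20.
have [r r0 hr] := osq_open sz1.
(* A nudge off 0, so that the inverse exists and inversion is continuous there. *)
pose z2 := if z1 == 0 then (Num.min (r / 2) (e / 6))%:C else z1.
have m0 : 0 < Num.min (r / 2) (e / 6) by rewrite lt_min !divr_gt0.
have [z20 nz2] : z2 != 0 /\ Normc.normc (z2 - z1) < Num.min r (e / 3).
  rewrite /z2; have [e1|ne1] := eqVneq z1 0; last first.
    by split=> //; rewrite subrr Normc.normc0 lt_min r0 e20.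
  split.
    by apply/eqP => /(congr1 (@complex.Re R)); rewrite ReReal ReZero => h; rewrite h ltxx in m0.
  rewrite e1 subr0 -[X in Normc.normc X]mulr1 normc_real ?ltW// Normc.normc1 mulr1.
  by rewrite lt_min !gt_min; apply/andP; split; apply/orP; [left|right]; lra.
move: nz2; rewrite lt_min => /andP[nr ne2].
have sz2 : insq true z2 by exact: hr.
have [r2 r20 hr2] := osq_open sz2.
have w0 : z2^-1 != 0 by rewrite invr_eq0.
have m20 : 0 < Num.min r2 (e / 3) by rewrite lt_min r20.
have [r3 r30 hr3] := inv_continuous w0 m20.
have [s gs ns] := IH _ (hsquare_sub z2^-1) _ r30.
have gd := nearest_gauss z2^-1; set d := nearest z2^-1 in gd ns.
have [ds0 hds] := hr3 (d + s) ltac:(by rewrite (_ : d + s - z2^-1 = s - (z2^-1 - d)); [|ring]).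
move: hds; rewrite invrK lt_min => /andP[h1 h2].
have hs := osq_hsquare (generic_osq gs).
exists (d + s)^-1; last first.
  have := normc_tri (d + s)^-1 z z2; have := normc_tri z2 z z1; lra.
split; first exact: hr2.
have y0 : (d + s)^-1 != 0 by rewrite invr_eq0.
split=> //; rewrite hurwitz_map_neq0// invrK nearestE// addrAC subrr add0r.
exact: gs.
Qed.

Lemma generic_open n y : generic n y -> exists2 r : R, 0 < r &
  forall y', Normc.normc (y' - y) < r -> generic n y' /\ expansion n y' = expansion n y.
Proof.
elim: n y => [|n IH] y; first by move=> [/osq_open[r r0 h] _]; exists r => // y' /h.
move=> [sy [y0 gT]]; have [r1 r10 h1] := osq_open sy; have [r2 r20 h2] := IH _ gT.
have [r3 r30 h3] := osq_open (generic_osq gT).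
have [r4 r40 h4] := inv_continuous y0 (e := Num.min r2 r3) ltac:(by rewrite lt_min r20).
exists (Num.min r1 r4); first by rewrite lt_min r10.
move=> y'; rewrite lt_min => /andP[k1 k2]; have [y'0] := h4 _ k2.
rewrite lt_min => /andP[k3 k4].
have gd := nearest_gauss y^-1; set d := nearest y^-1 in gd *.
have eT : T y = y^-1 - d by exact: hurwitz_map_neq0.
have et : y'^-1 - y^-1 = (y'^-1 - d) - T y by rewrite eT; ring.
have st : insq true (y'^-1 - d) by apply: h3; rewrite -et.
have ed : nearest y'^-1 = d.
  by rewrite -[y'^-1](subrK d) addrC nearestE//; exact: osq_hsquare.
have eT' : T y' = y'^-1 - d by rewrite hurwitz_map_neq0// ed.
have [g1 g2] := h2 (T y') ltac:(by rewrite eT' -et).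
split; first by split; [exact: h1|].
by rewrite /= ed g2.
Qed.

(* Lebesgue number argument: [v] may be taken close to [w] but sees every line
   and circle that passes near [w] as passing through it. *)
Lemma unsep_uniform : exists2 eta : R, 0 < eta & forall w, insq false w ->
  exists2 v, insq false v & forall x, Normc.normc (x - w) < eta ->
    Normc.normc (x - v) <= 1 / 10 /\ unsep v x.
Proof.
pose P (e : R) (p : R * R) := exists2 v, insq false v &
  forall x, Normc.normc (x - (p.1 +i* p.2)) < e -> Normc.normc (x - v) <= 1 / 10 /\ unsep v x.
have cK := compact_setX (@segment_compact R (- 2^-1) 2^-1) (@segment_compact R (- 2^-1) 2^-1).
move/compact_near_coveringP: cK => /(_ R (0 : R)^'+ P _).
case.
- move=> [p q] [/=]; rewrite !in_itv /= => /andP[p1 p2] /andP[q1 q2].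
  have sv : insq false (p +i* q) by apply/csqP.
  have [r [r0 r1 hr]] := unsep_near sv.
  have r40 : 0 < r / 4 by lra.
  (* The base point moves by less than [r / 2] and [x] by less than [r / 2], so [x] stays within [r]
     of the original point. *)
  exists (ball (p, q) (r / 4), [set e | 0 < e < r / 2]).
    split; first exact: nbhsx_ballx.
    by near=> e => /=; apply/andP; split; near: e; [exact: nbhs_right_gt|apply: nbhs_right_lt; lra].
  move=> [[p' q'] e] [[/= hp hq] /andP[e0 e1]].
  exists (p +i* q) => // x /= hx.
  have np : `|p - p'| < r / 4 by move: hp; rewrite -ball_normE.
  have nq : `|q - q'| < r / 4 by move: hq; rewrite -ball_normE.
  have : Normc.normc ((p' +i* q') - (p +i* q)) < r / 2.
    rewrite normc_lt; last lra.
    rewrite /n2 ReAdd ImAdd ReOpp ImOpp !ReMk !ImMk.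
    by move: np nq; rewrite !ltr_norml => /andP[? ?] /andP[? ?]; nra.
  have := normc_tri x (p +i* q) (p' +i* q') => h1 h2.
  have h3 : Normc.normc (x - (p +i* q)) < r by lra.
  by split; [lra|exact: hr].
- move=> e /= e0 he; exists (e / 2); first by lra.
  move=> w sw; have e2 : 0 < e / 2 by lra.
  have be : ball_ [eta Num.Def.normr] 0 e (e / 2).
    by rewrite /ball_ /= sub0r normrN gtr0_norm//; lra.
  have [|v sv hv] := he _ be e2 (Re w, Im w).
    by move/csqP: sw => [? ? ? ?]; split; rewrite /= in_itv /=; apply/andP.
  by exists v => // x; move: hv; rewrite /= (_ : Re w +i* Im w = w); [exact|case: (w)].
Unshelve. all: by end_near.
Qed.

End Topology.

(** * Cylinders *)

Section Main.
Context (R : realType).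
Implicit Types z w u c d t x y v s : R[i].
Local Notation T := (@hurwitz_map R).
Local Notation state := (foldl (@shift_centers R) set0).

Lemma cylinderE n (a : n.-tuple R[i]) y :
  cylinder a y <-> hsquare y /\ expansion n y = a :> seq _.
Proof.
split=> -[hy h]; split=> //.
  apply: (@eq_from_nth _ 0); first by rewrite size_expansion size_tuple.
  rewrite size_expansion => j jn; rewrite nth_expansion//.
  by rewrite (h (Ordinal jn)) (tnth_nth 0).
by move=> j; rewrite (tnth_nth 0) -h nth_expansion.
Qed.

Lemma hdigits_digit d : hdigits d <-> digit d.
Proof.
split=> -[gd h]; split=> //.
  by rewrite n2_normc -(@sqr_sqrtr R 2)// ler_pXn2r// ?nnegrE ?sqrtr_ge0 ?normc_ge0.
rewrite -(@ler_pXn2r _ 2)// ?nnegrE ?sqrtr_ge0 ?normc_ge0//.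
by rewrite sqr_sqrtr// -n2_normc.
Qed.

Lemma generic_regular n y (b : n.-tuple R[i]) : generic n y -> expansion n y = b :> seq _ ->
  regular_word b.
Proof.
move=> g e; split.
  move=> j; apply/hdigits_digit; apply: (generic_digits g).
  by rewrite e mem_tnth.
have [r r0 h] := generic_open g; exists y; apply/nbhs_normc; exists r => // y' /h[g' e'].
by apply/cylinderE; split; [apply/osq_hsquare/generic_osq; exact: g'|rewrite e'].
Qed.

(** A cylinder with interior contains a generic point, at which admissibility is free of boundary
    ties. *)
Lemma regular_admissible n (a : n.-tuple R[i]) : regular_word a ->
  digits a /\ admissible_word set0 a.
Proof.
move=> [hd [z /nbhs_normc[r r0 h]]]; split.
  by move=> d /tnthP[j ->]; exact/hdigits_digit.
have [hz _] : cylinder a z by apply: h; rewrite subrr Normc.normc0.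
have [y g hy] := generic_dense n hz r0.
have /cylinderE[_ <-] := h _ hy.
apply: (generic_admissible _ g); first by move=> c [].
by split=> //; exact/osq_csq/(generic_osq g).
Qed.

Lemma regular_state n (b : n.-tuple R[i]) : regular_word b ->
  state b `<=` @gcenter R /\ (forall u, gunit u -> state b u -> state b (- u) -> False).
Proof.
move=> /regular_admissible[hb _]; split; first by apply: state_sub => c [].
by move=> u; exact: state_no_opp.
Qed.

Lemma set0_sub : set0 `<=` @gcenter R. Proof. by []. Qed.

Lemma cylinder_tile n (a : n.-tuple R[i]) y : regular_word a -> cylinder a y ->
  [/\ tile false (state a) (iter n T y), fchain a (iter n T y) & branch a (iter n T y) = y].
Proof.
move=> /regular_admissible[ha _] /cylinderE[hy e]; rewrite -e in ha *.
split; [|exact: fchain_expansion|exact: branch_expansion].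
by apply: tile_expansion => //; split=> //; exact: hsquare_csq.
Qed.

Lemma tile_cylinder n (a : n.-tuple R[i]) t : regular_word a -> tile true (state a) t ->
  cylinder a (branch a t).
Proof.
move=> /regular_admissible[ha aa] h; apply/cylinderE.
have [h1 h2 _] := tile_branch_expansion set0_sub ha aa h.
by split=> //; move: h2; rewrite size_tuple.
Qed.

Lemma diam_bprod n (a : n.-tuple R[i]) z : regular_word a -> cylinder a z ->
  diam (cylinder a) <= 4 * expR 4 * bprod a (iter n T z).
Proof.
move=> ra Cz; have [ha _] := regular_admissible ra.
have [[sw _] fw ew] := cylinder_tile ra Cz.
have p0 := bprod_gt0 ha fw.
have key x : cylinder a x -> Normc.normc (x - z) <= 2 * expR 4 * bprod a (iter n T z).
  move=> Cx; have [[sx _] fx ex] := cylinder_tile ra Cx.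
  have [|_] := branch_contract ha fx fw.
    have := normc_tri (iter n T x) (iter n T z) 0; rewrite subr0 sub0r normcN.
    by have := normc_csq sx; have := normc_csq sw; lra.
  rewrite ew ex => h; apply: le_trans h _; rewrite ler_wpM2r ?(ltW p0)//.
  rewrite ler_wpM2l// ler_expR.
  have : 0 <= 2^-1 ^+ size a :> R by rewrite exprn_ge0.
  lra.
apply: ge_sup; first by exists (Normc.normc (z - z)), z, z.
move=> _ [x [y [Cx Cy ->]]]; have := normc_tri x y z; rewrite [Normc.normc (z - y)]normcB.
by have := key _ Cx; have := key _ Cy; lra.
Qed.

Lemma diam_gt0 n (a : n.-tuple R[i]) : regular_word a -> 0 < diam (cylinder a).
Proof.
move=> ra; have [_ [z /nbhs_normc[r r0 h]]] := ra.
have Cz : cylinder a z by apply: h; rewrite subrr Normc.normc0.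
pose y := z + (r / 2)%:C * 1.
have ny : Normc.normc (y - z) = r / 2.
  by rewrite /y addrAC subrr add0r normc_real ?Normc.normc1 ?mulr1//; lra.
have Cy : cylinder a y by apply: h; rewrite ny; lra.
apply: (@lt_le_trans _ _ (r / 2)); first by lra.
apply: ub_le_sup; last by exists y, z.
exists 2 => _ [x [x' [/cylinderE[hx _] /cylinderE[hx' _] ->]]].
have := normc_tri x x' 0; rewrite subr0 sub0r normcN.
by have := normc_csq (hsquare_csq hx); have := normc_csq (hsquare_csq hx'); lra.
Qed.

(* The point [branch a v] belongs to every tile close to [z], and each of these
   tiles contains one of the finitely many rays [v + r th] with [th] in [dirs v]. *)
Lemma local_tiles (eta0 : R) : 0 < eta0 ->
  (forall w, insq false w -> exists2 v, insq false v &
     forall x, Normc.normc (x - w) < eta0 -> Normc.normc (x - v) <= 1 / 10 /\ unsep v x) ->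
  forall n (a : n.-tuple R[i]) z, regular_word a -> cylinder a z ->
  exists v, forall (b : n.-tuple R[i]) y, regular_word b -> cylinder b y ->
    Normc.normc (y - z) <= Num.min (eta0 / 2) 4^-1 / 2 * bprod a (iter n T z) ->
    exists2 th, th \in dirs v & exists2 r0, 0 < r0 & forall r : R, 0 < r -> r < r0 ->
      cylinder b (branch a (v + r%:C * th)) /\
      Normc.normc (branch a (v + r%:C * th) - branch a v) <= r * Normc.normc th.
Proof.
move=> e00 he n a z ra Cz; have [ha aa] := regular_admissible ra.
have [tw fw ew] := cylinder_tile ra Cz; have [sw cw] := tw.
have [v sv hv] := he _ sw; exists v => b y rb Cb ny.
have [ww usw] := hv (iter n T z) ltac:(by rewrite subrr Normc.normc0).
have m0 : 0 < Num.min (eta0 / 2) 4^-1 by rewrite lt_min !divr_gt0/=; lra.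
have [SEa _] := regular_state ra; have [SEb oppb] := regular_state rb.
(* If [v] were inside a removed disc, [unsep] would put [iter n T z] inside it too. *)
have tv : tile false (state a) v.
  split=> // c Sc; have [gc _] := SEa _ Sc; rewrite /= leNgt; apply/negP => lt1.
  by have [_ _ us] := usw; have := us _ gc lt1; have := cw _ Sc; rewrite /=; lra.
have [_ fv] := tile_branch set0_sub ha aa tv.
(* [y] gets a coordinate [t] in the chart of [a] even when it lies outside the cylinder of [a]. *)
have [|||t et nt] := branch_surj _ _ ha fw (y := y) (eta := Num.min (eta0 / 2) 4^-1).
- exact: ltW.
- by rewrite ge_min lexx orbT.
- rewrite ew; apply: le_trans ny _; rewrite ler_wpM2r ?(ltW (bprod_gt0 ha fw))//.
  have q0 : 0 <= 2^-1 ^+ size a :> R by rewrite exprn_ge0.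
  by have := mulr_ge0 q0 (ltW m0); lra.
have {}nt : Normc.normc (t - iter n T z) < eta0.
  by apply: le_lt_trans nt _; rewrite gt_min; apply/orP; left; lra.
have [vt ust] := hv _ nt.
have [/cylinderE[hy ey] [hb _]] := (Cb, regular_admissible rb).
have bt : mob (Moeb 1 0 0 1) (branch a t) = y by rewrite mob_idE.
have [|m' [ch' em' wk]] := chart_walk ha fv vt ust (chart_id (branch a v)).
  by rewrite bt size_tuple ey.
rewrite bt size_tuple in em' wk; rewrite ey in wk.
have [ty _ _] := cylinder_tile rb Cb.
have tm : tile false (state b) (mob m' v).
  have [gm d1 sy c2] := ch'; split; first exact: sqsym_csq sy sv.
  move=> c Sc; have [gc hc] := SEb _ Sc; rewrite /= leNgt; apply/negP => lt1.
  (* At 0 the bound on [mc] may be 2, out of reach of [mob_circle]; but the image is then 0, which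
     no disc contains in its interior. *)
  have [v0|v0] := eqVneq v 0.
    have p0 : mob m' v = 0 by apply/eqP; rewrite -n2_eq0 (sqsym_n2 sy) v0 n2_0.
    by move: lt1; rewrite p0 sub0r n2N; case: hc => ->; lra.
  have := mob_circle gm (chart_neq0 v0 ch') d1 vt ust gc lt1.
  by rewrite em'; have [_ h] := ty; have := h _ Sc; rewrite /=; lra.
have [th hth [r0 r00 hr]] := mob_tile_dir SEb sv ch' oppb tm.
exists th => //.
exists (Num.min r0 (1 / 10 / (Normc.normc th + 1))).
  by have := normc_ge0 th => h; rewrite lt_min r00 divr_gt0//; lra.
move=> r rp; rewrite lt_min => /andP[r1 r2].
have nr : Normc.normc (v + r%:C * th - v) = r * Normc.normc th.
  by rewrite addrAC subrr add0r normc_real ?ltW.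
have nr1 : Normc.normc (v + r%:C * th - v) <= 1 / 10.
  rewrite nr; have := normc_ge0 th => h.
  by move: r2; rewrite ltr_pdivlMr; [nra|lra].
split; last by rewrite -nr; exact: branch_near.
rewrite -(mob_idE (branch a _)) wk//.
by apply: tile_cylinder => //; exact: hr.
Qed.

Lemma ray_closure n (a b : n.-tuple R[i]) v th (r0 : R) : 0 < r0 ->
  (forall r : R, 0 < r -> r < r0 -> cylinder b (branch a (v + r%:C * th)) /\
      Normc.normc (branch a (v + r%:C * th) - branch a v) <= r * Normc.normc th) ->
  closure (cylinder b) (branch a v).
Proof.
move=> r00 h; apply/closure_normc => e e0; have th0 := normc_ge0 th.
pose r := Num.min (r0 / 2) (e / (Normc.normc th + 1)).
have rp : 0 < r by rewrite lt_min !divr_gt0//; lra.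
have r1 : r < r0 by rewrite gt_min; apply/orP; left; lra.
have r2 : r * (Normc.normc th + 1) <= e by rewrite -ler_pdivlMr ?ge_min ?lexx ?orbT//; lra.
have [C1 n1] := h _ rp r1; exists (branch a (v + r%:C * th)) => //.
by apply: le_lt_trans n1 _; lra.
Qed.

End Main.

Theorem theorem5p3 (R : realType) :
  exists rho : R, 0 < rho /\
    forall (n : nat) (a : n.-tuple R[i]) (z : R[i]),
      regular_word a -> closure (cylinder a) z ->
      [/\ (near_words z a rho #<= `I_6)%card,
          near_words z a rho `<=` [set a] `|` neighbors a
        & disc z (rho * diam (cylinder a)) `&` closure (@hsquare R)
            `<=` \bigcup_(b in near_words z a rho) closure (cylinder b)].
Proof.
have [eta e0 he] := unsep_uniform R.
(* Halving [eta] makes the final bound strict; 1/4 is the limit imposed by [branch_surj]. *)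
pose eta1 := Num.min (eta / 2) 4^-1.
have m0 : 0 < eta1 by rewrite lt_min !divr_gt0/=; lra.
have E0 : 0 < expR (4 : R) by exact: expR_gt0.
have rho0 : 0 < eta1 / (16 * expR 4) by rewrite divr_gt0// mulr_gt0.
(* By [diam_bprod], [rho * D] is at most [eta1 / 4 * bprod]. Twice this is the radius in
   [local_tiles]; the factor 2 pays for replacing [z] in the closure by [z'] in the cylinder. *)
exists (eta1 / (16 * expR 4)); split=> // n a z ra cz.
set rho := eta1 / _ in rho0 *.
have d0 := diam_gt0 ra; set D := diam (cylinder a) in d0 *.
have rd : 0 < rho * D by exact: mulr_gt0.
have [z' Cz' nz'] := (closure_normc _ _).1 cz _ rd.
have [v hv] := local_tiles e0 he ra Cz'.
have near y : Normc.normc (y - z) < rho * D ->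
    Normc.normc (y - z') <= eta1 / 2 * bprod a (iter n (@hurwitz_map R) z').
  move=> ny; have := normc_tri y z' z; rewrite [Normc.normc (z - z')]normcB.
  have Dle := diam_bprod ra Cz'; rewrite -/D in Dle.
  have : rho * D <= eta1 / 4 * bprod a (iter n (@hurwitz_map R) z').
    rewrite (_ : eta1 / 4 = rho * (4 * expR 4)) -?mulrA ?ler_wpM2l ?mulrA// ?ltW//.
    by rewrite /rho; field; rewrite gt_eqF.
  lra.
have approx b : near_words z a rho b -> regular_word b /\
    exists2 y, cylinder b y & Normc.normc (y - z) < rho * D.
  move=> [rb [y [/ball_normc ny cy]]]; split=> //.
  have s0 : 0 < rho * D - Normc.normc (z - y) by rewrite subr_gt0.
  have [y' Cy' ny'] := (closure_normc _ _).1 cy _ s0.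
  exists y' => //; have := normc_tri y' z y; rewrite [Normc.normc (y - z)]normcB; lra.
have ray b : near_words z a rho b -> exists2 th, th \in dirs v & exists2 r0, 0 < r0 &
    forall r : R, 0 < r -> r < r0 -> cylinder b (branch a (v + r%:C * th)) /\
      Normc.normc (branch a (v + r%:C * th) - branch a v) <= r * Normc.normc th.
  move=> /approx[rb [y Cy ny]]; apply: hv Cy _ => //; exact: near.
have card6 : (near_words z a rho #<= `I_6)%card.
  pose dir b : R[i] := if pselect (near_words z a rho b) is left h
    then sval (cid2 (ray b h)) else 0.
  (* Two words with the same direction share a point on a short ray, and a point determines its
     word. *)
  apply/pcard_leP/injfunPex; exists (fun b => index (dir b) (dirs v)).
    move=> b /= hb; rewrite /dir; case: pselect => // h; case: cid2 => th /= hth _.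
    by apply: leq_trans (size_dirs v); rewrite index_mem.
  move=> b b'; rewrite !inE => hb hb'; rewrite /dir; case: pselect => // h; case: pselect => // h'.
  case: cid2 => th /= hth [r r0 hr]; case: cid2 => th' /= hth' [r' r0' hr'].
  move=> /(congr1 (nth 0 (dirs v))); rewrite !nth_index// => e; rewrite -{th' hth'}e in hr'.
  have q0 : 0 < Num.min r r' / 2 by rewrite divr_gt0// lt_min r0.
  have [q1 q2] : Num.min r r' / 2 < r /\ Num.min r r' / 2 < r'.
    have : Num.min r r' <= r by rewrite ge_min lexx.
    have : Num.min r r' <= r' by rewrite ge_min lexx orbT.
    by split; lra.
  have [/cylinderE[_ e1] _] := hr _ q0 q1; have [/cylinderE[_ e2] _] := hr' _ q0 q2.
  by apply: val_inj; rewrite /= -e1 -e2.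
split=> //.
- move=> b hb; have [ba|ba] := eqVneq b a; first by left.
  right; have [rb _] := hb; split=> //; first exact/eqP.
  exists (branch a v); split.
    (* Applied to [a] itself, the ray argument puts [branch a v] in the closure of its own cylinder;
       this is the common point with that of [b]. *)
    have [|th _ [r0 r00 hr]] := hv a z' ra Cz'; last exact: ray_closure hr.
    rewrite subrr Normc.normc0 mulr_ge0 ?ltW//; first by rewrite divr_gt0.
    have [ha _] := regular_admissible ra; have [_ fw _] := cylinder_tile ra Cz'.
    exact: bprod_gt0.
  by have [th _ [r0 r00 hr]] := ray _ hb; exact: ray_closure hr.
- move=> y [/ball_normc ny cy].
  have fin : finite_set (near_words z a rho) by apply: card_le_finite card6 _; exact: finite_II.
  (* Finiteness makes the union closed, so it suffices to approximate [y] by generic points, each of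
     which lies in the cylinder of a regular word. *)
  have : closed (\bigcup_(b in near_words z a rho) closure (cylinder b)).
    by apply: closed_bigcup => // b _; exact: closed_closure.
  apply; apply/closure_normc => e ep.
  have s0 : 0 < Num.min e (rho * D - Normc.normc (z - y)) / 2.
    by rewrite divr_gt0// lt_min ep subr_gt0.
  have [y1 hy1 n1] := (closure_normc _ _).1 cy _ s0.
  have [y2 g2 n2'] := generic_dense n hy1 s0.
  have h1 : Num.min e (rho * D - Normc.normc (z - y)) <= e by rewrite ge_min lexx.
  have h2 : Num.min e (rho * D - Normc.normc (z - y)) <= rho * D - Normc.normc (z - y).
    by rewrite ge_min lexx orbT.
  have n3 := normc_tri y2 y y1.
  have sz : size (expansion n y2) == n by rewrite size_expansion.
  pose b := Tuple sz.
  have rb : regular_word b by exact: generic_regular g2 _.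
  have Cb : cylinder b y2 by apply/cylinderE; split=> //; apply/osq_hsquare/generic_osq; exact: g2.
  have cb : closure (cylinder b) y2 by exact: subset_closure.
  exists y2; last by lra.
  exists b => //; split=> //; exists y2; split=> //; apply/ball_normc.
  rewrite -/D; have := normc_tri z y2 y; rewrite [Normc.normc (y - y2)]normcB; lra.
Qed.
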